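(* Let $G$ be a discrete group acting properly on a space with walls $(Y,\mathcal H)$ with set of walls $W$. Let $X$ be the cube complex associated to $(Y,\mathcal H)$ (defined in the context). Then $X$ is a CAT(0) cube complex, the formula $(g\sigma)(\overline h)=g\big(\sigma(g^{-1}\overline h)\big)$ defines an action of $G$ on $X$ by cellular isometries, and this action is proper. Moreover, if $I(W)$ is finite then $\dim X=I(W)$.
   Context: A space with walls is a set $Y$ together with a non-empty collection $\mathcal H\subset\mathcal P(Y)$ of non-empty subsets (half-spaces) such that $h\in\mathcal H$ implies $h^c=Y\setminus h\in\mathcal H$, and such that for any $p,q\in Y$ only finitely many $h\in\mathcal H$ satisfy $p\in h$, $q\in h^c$ (such $h$ separates $p$ from $q$). Walls are pairs $\overline h=\{h,h^c\}$, $W=\mathcal H/\ast$. Two walls $\{h,h^c\},\{k,k^c\}$ cross if $h\cap k$, $h\cap k^c$, $h^c\cap k$, $h^c\cap k^c$ are all non-empty; $I(W)$ is the supremum of the sizes of families of pairwise crossing walls. Pseudo-metric: $d(p,q)=$ number of walls separating $p$ and $q$. $G$ acts on the space with walls if it acts on $Y$ with $g(\mathcal H)=\mathcal H$; the action is proper if $d(g_np,p)\to\infty$ for every $p\in Y$ and every sequence $g_n$ leaving every finite subset of $G$. An admissible section is a map $\sigma:W\to\mathcal H$ with $\sigma(\overline h)\in\overline h$ for all $\overline h$ and $\sigma(\overline h)\not\subseteq\sigma(\overline k)^c$ for all $\overline h,\overline k\in W$. Let $\Gamma$ be the graph whose vertices are admissible sections, two joined by an edge iff they differ on exactly one wall (the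 edge is labelled by that wall). For $p\in Y$, $\sigma_p(\overline h)$ is the element of $\{h,h^c\}$ containing $p$; $\Gamma_p$ is the connected component of $\Gamma$ containing $\sigma_p$ (it is independent of $p$). A $k$-corner is a vertex $\sigma$ of $\Gamma_p$ together with $k$ edges at $\sigma$ whose labelling walls pairwise cross; each $k$-corner lies in a unique subgraph of $\Gamma_p$ isomorphic to the 1-skeleton of a $k$-cube. The cube complex $X$ is obtained from $X^1=\Gamma_p$ by attaching, for each $k$-corner ($k\ge2$), a Euclidean unit $k$-cube along the corresponding subgraph isomorphic to the 1-skeleton of a $k$-cube. *)

(* Defs.v *)
From mathcomp Require Import all_boot all_order all_algebra.
From mathcomp Require Import all_classical all_reals.
From Stdlib Require Import List Relations.
Set Implicit Arguments. Unset Strict Implicit. Unset Printing Implicit Defensive.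
Import Order.TTheory GRing.Theory Num.Theory.
Local Open Scope classical_set_scope.
Local Open Scope ring_scope.

Definition space_with_walls {Y : Type} (H : set (set Y)) : Prop :=
  [/\ H !=set0, (forall h, H h -> h !=set0), (forall h, H h -> H (~` h)) &
      (forall p q : Y, finite_set [set h | H h /\ h p /\ ~ h q])].

Definition wall {Y : Type} (h : set Y) : set (set Y) :=
  [set k | k = h \/ k = ~` h].

Definition is_wall {Y : Type} (H : set (set Y)) (w : set (set Y)) : Prop :=
  exists2 h, H h & w = wall h.

Definition crosses {Y : Type} (H : set (set Y)) (w k : set (set Y)) : Prop :=
  exists h k', [/\ H h, H k', w = wall h, k = wall k' &
    [/\ (h `&` k') !=set0, (h `&` ~` k') !=set0,
        (~` h `&` k') !=set0 & (~` h `&` ~` k') !=set0]].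

Definition pairwise_crossing {Y : Type} (H : set (set Y))
    (E : list (set (set Y))) : Prop :=
  [/\ NoDup E, (forall w, In w E -> is_wall H w) &
      (forall w k, In w E -> In k E -> w <> k -> crosses H w k)].

Definition I_ge {Y : Type} (H : set (set Y)) (n : nat) : Prop :=
  exists E, length E = n /\ pairwise_crossing H E.

Definition I_is {Y : Type} (H : set (set Y)) (n : nat) : Prop :=
  I_ge H n /\ forall m, I_ge H m -> (m <= n)%N.

Definition sep_ge {Y : Type} (H : set (set Y)) (p q : Y) (m : nat) : Prop :=
  exists E : list (set Y), [/\ length E = m, NoDup E &
     forall h, In h E -> [/\ H h, h p & ~ h q]].

Definition is_group {G : Type} (mul : G -> G -> G) (one : G) (inv : G -> G) :=
  [/\ forall a b c, mul a (mul b c) = mul (mul a b) c,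
      forall a, mul one a = a,
      forall a, mul a one = a,
      forall a, mul (inv a) a = one &
      forall a, mul a (inv a) = one].

Definition is_action {G T : Type} (mul : G -> G -> G) (one : G)
    (act : G -> T -> T) :=
  (forall y, act one y = y) /\ (forall g k y, act (mul g k) y = act g (act k y)).

Definition acts_on_walls {G Y : Type} (H : set (set Y)) (act : G -> Y -> Y) :=
  forall g, (fun h => act g @` h) @` H = H.

Definition leaves_finite {G : Type} (gs : nat -> G) : Prop :=
  forall F : set G, finite_set F -> exists N, forall n, (N <= n)%N -> ~ F (gs n).

Definition proper_on_walls {G Y : Type} (H : set (set Y)) (act : G -> Y -> Y) :=
  forall (p : Y) (gs : nat -> G), leaves_finite gs ->
    forall m : nat, exists N, forall n, (N <= n)%N -> sep_ge H (act (gs n) p) p m.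

(* A section is a map W -> H; we use functions on set (set Y), only their
   values on walls matter. *)
Definition section (Y : Type) := set (set Y) -> set Y.

Definition admissible {Y : Type} (H : set (set Y)) (s : section Y) : Prop :=
  (forall w, is_wall H w -> w (s w)) /\
  (forall w k, is_wall H w -> is_wall H k -> ~ (s w `<=` ~` (s k))).

Definition flip_at {Y : Type} (H : set (set Y)) (s t : section Y)
    (w : set (set Y)) : Prop :=
  [/\ is_wall H w, s w <> t w &
      forall k, is_wall H k -> k <> w -> s k = t k].

Definition gedge {Y : Type} (H : set (set Y)) (s t : section Y) : Prop :=
  [/\ admissible H s, admissible H t & exists w, flip_at H s t w].

Definition in_Gamma {Y : Type} (H : set (set Y)) (p : Y) (s : section Y) :=
  admissible H s /\
  exists t : section Y, (forall w, is_wall H w -> t w p) /\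
                        clos_refl_trans _ (gedge H) t s.

Definition corner {Y : Type} (H : set (set Y)) (p : Y) (s : section Y)
    (E : list (set (set Y))) : Prop :=
  [/\ in_Gamma H p s, pairwise_crossing H E &
      forall w, In w E -> exists t, [/\ in_Gamma H p t, gedge H s t & flip_at H s t w]].

(* ---------------- The cube complex X (geometric realization) ----------------
   A point of X is a function x : set Y -> R giving a weight in [0,1] to each
   halfspace (x h^c = 1 - x h, x = 0 off H). The cube attached along the
   corner (s,E) consists of the x which are 0/1-valued according to s on walls
   outside E and arbitrary in [0,1] on walls of E (coordinates x (s w), w in E). *)

Definition incube {R : realType} {Y : Type} (H : set (set Y)) (p : Y)
    (s : section Y) (E : list (set (set Y))) (x : set Y -> R) : Prop :=
  [/\ corner H p s E,
      (forall h, ~ H h -> x h = 0) &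
      (forall h, H h ->
         (In (wall h) E -> 0 <= x h <= 1 /\ x (~` h) = 1 - x h) /\
         (~ In (wall h) E -> (s (wall h) = h -> x h = 1) /\
                             (s (wall h) <> h -> x h = 0)))].

Definition inX {R : realType} {Y : Type} (H : set (set Y)) (p : Y)
    (x : set Y -> R) : Prop :=
  exists s E, incube H p s E x.

Definition cube_dist {R : realType} {Y : Type} (s : section Y)
    (E : list (set (set Y))) (x y : set Y -> R) : R :=
  Num.sqrt (\sum_(w <- E) (x (s w) - y (s w)) ^+ 2).

Definition chain_length {R : realType} {Y : Type} (H : set (set Y)) (p : Y)
    (x y : set Y -> R) (L : R) : Prop :=
  exists (n : nat) (z : nat -> set Y -> R)
         (c : nat -> section Y * list (set (set Y))),
    [/\ z 0%N = x, z n = y,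
        (forall i, (i < n)%N ->
           incube H p (c i).1 (c i).2 (z i) /\ incube H p (c i).1 (c i).2 (z i.+1)) &
        L = \sum_(i < n) cube_dist (c i).1 (c i).2 (z i) (z i.+1)].

Definition dX {R : realType} {Y : Type} (H : set (set Y)) (p : Y)
    (x y : set Y -> R) : R :=
  inf [set L | chain_length H p x y L].

Definition is_metric_on {R : realType} {T : Type} (S : set T) (d : T -> T -> R) :=
  forall x y z, S x -> S y -> S z ->
    [/\ d x y = 0 <-> x = y, d x y = d y x & d x z <= d x y + d y z].

Definition is_geodesic {R : realType} {T : Type} (S : set T) (d : T -> T -> R)
    (x y : T) (g : R -> T) : Prop :=
  [/\ g 0 = x, g (d x y) = y &
      forall s t, 0 <= s <= d x y -> 0 <= t <= d x y ->
        S (g s) /\ d (g s) (g t) = `|s - t|].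

(* CAT(0): geodesic metric space in which, for every geodesic triangle, the
   distance between a point at distance s from a on a side [a,b] and a point at
   distance t from a on a side [a,c] is at most the corresponding distance in
   the Euclidean comparison triangle (law of cosines). *)
Definition CAT0 {R : realType} {T : Type} (S : set T) (d : T -> T -> R) : Prop :=
  [/\ is_metric_on S d,
      (forall x y, S x -> S y -> exists g, is_geodesic S d x y g) &
      (forall a b c g1 g2, S a -> S b -> S c ->
         is_geodesic S d a b g1 -> is_geodesic S d a c g2 ->
         forall s t, 0 <= s <= d a b -> 0 <= t <= d a c ->
           d (g1 s) (g2 t) ^+ 2 <=
             s ^+ 2 + t ^+ 2 -
             s * t * (d a b ^+ 2 + d a c ^+ 2 - d b c ^+ 2) / (d a b * d a c))].

Definition wimg {G Y : Type} (act : G -> Y -> Y) (g : G) (w : set (set Y)) :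
  set (set Y) := (fun h => act g @` h) @` w.

Definition gsec {G Y : Type} (inv : G -> G) (act : G -> Y -> Y) (g : G)
    (s : section Y) : section Y :=
  fun w => act g @` (s (wimg act (inv g) w)).

Definition actX {R : realType} {G Y : Type} (inv : G -> G) (act : G -> Y -> Y)
    (g : G) (x : set Y -> R) : set Y -> R :=
  fun h => x (act (inv g) @` h).

Definition vpt {R : realType} {Y : Type} (H : set (set Y)) (s : section Y) :
  set Y -> R :=
  fun h => if `[< H h /\ s (wall h) = h >] then 1 else 0.

Definition dim_is {Y : Type} (H : set (set Y)) (p : Y) (n : nat) : Prop :=
  (exists s E, corner H p s E /\ length E = n) /\
  (forall s E, corner H p s E -> (length E <= n)%N).

(* Main.v *)
Require Import Defs.
From mathcomp Require Import all_boot all_order all_algebra.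
From mathcomp Require Import all_classical all_reals.
From mathcomp Require Import ring lra.
From Stdlib Require Import List Relations.
Import Order.TTheory GRing.Theory Num.Theory.
Local Open Scope classical_set_scope.
Local Open Scope ring_scope.

(** A point of X is a weight function on half-spaces, and the cubes of X can be
    forgotten: such a function is a point of X iff it vanishes on one of any two
    disjoint half-spaces of distinct walls (and almost agrees with the base point),
    and two points share a cube iff this holds simultaneously for both. The path
    metric is then the largest pseudo-metric bounded by the Euclidean distance on
    cubes, so that any map that is subadditive and 1-Lipschitz on cubes is
    1-Lipschitz; this applies to the coordinates, to the l2-distance over any set of
    walls (whence properness) and to the gate map onto a convex subcomplex.

    CAT(0) is used in the form of the Bruhat-Tits inequality: any q, r have a point m
    at each ratio l with d(p,m)^2 <= (1-l)d(p,q)^2 + l d(p,r)^2 - l(1-l)d(q,r)^2 for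
    all p. It is proved by induction on the number of walls of a finite convex
    subcomplex Z. A wall w cuts Z into the two half-spaces {w = 0}, {w = 1} and the
    tube of all cubes crossing w, which is the product of a smaller subcomplex with
    [0,1]; two applications of Reshetnyak's gluing theorem give Z. Geodesics of X lie
    in convex hulls of finitely many points, which are finite. *)

(** The usual route to CAT(0), Gromov's link condition followed by a local-to-global theorem, is
    inconvenient here: X may have cubes of unbounded dimension and be neither locally compact nor
    complete. The CN inequality is therefore demanded at every ratio and not only at midpoints, so
    that geodesics come without completeness. Gluing takes place between subsets of the one metric
    space X; its essential input is that the distance between points of the two sides is realised
    through a point of the cut. On a convex subcomplex separated by finitely many walls this minimum
    exists because only finitely many coordinates vary. Paths between two points of a subcomplex may
    leave it; the gate map pulls them back without lengthening them, so the metric of X can be used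
    on subcomplexes throughout. The condition on disjoint half-spaces is the fractional form of
    admissibility of a section. *)

Set Implicit Arguments.
Unset Strict Implicit.

(** * Reshetnyak gluing for the CN inequality *)

Section Gluing.
Context {R : realType} {T : Type}.
Variables (X : set T) (d : T -> T -> R).
Hypothesis hd : is_metric_on X d.

Lemma metric_refl x : X x -> d x x = 0.
Proof. by move=> Xx; have [[_ h] _ _] := hd Xx Xx Xx; exact: h. Qed.

Lemma metric_sym x y : X x -> X y -> d x y = d y x.
Proof. by move=> Xx Xy; have [_ h _] := hd Xx Xy Xy. Qed.

Lemma metric_tri x y z : X x -> X y -> X z -> d x z <= d x y + d y z.
Proof. by move=> Xx Xy Xz; have [_ _ h] := hd Xx Xy Xz. Qed.

Lemma metric_eq0 x y : X x -> X y -> d x y = 0 -> x = y.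
Proof. by move=> Xx Xy; have [[h _] _ _] := hd Xx Xy Xy. Qed.

Lemma metric_ge0 x y : X x -> X y -> 0 <= d x y.
Proof.
move=> Xx Xy; have := metric_tri Xx Xy Xx.
by rewrite metric_refl // (metric_sym Xy Xx); lra.
Qed.

(** Test points are confined to [A], so that one [m] can be certified against a piece first and
    against the glued space later. *)
Definition cn_point (A : set T) (q r : T) (l : R) (m : T) : Prop :=
  forall p, A p -> d p m ^+ 2 <=
    (1 - l) * d p q ^+ 2 + l * d p r ^+ 2 - l * (1 - l) * d q r ^+ 2.

Definition cn_space (A : set T) : Prop :=
  forall q r (l : R), A q -> A r -> 0 <= l <= 1 -> exists2 m, A m & cn_point A q r l m.

(** Stewart's relation as an inequality: for [m] on a geodesic from [q] to [r] it is the CN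
    inequality with denominators cleared, ready for linear combinations. *)
Definition stewart (p q m r : T) : Prop :=
  (d q m + d m r) * d p m ^+ 2 + d q m * d m r * (d q m + d m r) <=
  d m r * d p q ^+ 2 + d q m * d p r ^+ 2.

Lemma ler_of_sqr (x y : R) : 0 <= y -> x ^+ 2 <= y ^+ 2 -> x <= y.
Proof. move=> y0 h; rewrite leNgt; apply/negP => lt; nra. Qed.

(** The test points [q] and [r] bound the two distances from above; the triangle inequality leaves
    no room below. *)
Lemma cn_point_dist A q r (l : R) m : A `<=` X -> A q -> A r -> A m -> 0 <= l <= 1 ->
  cn_point A q r l m -> d q m = l * d q r /\ d m r = (1 - l) * d q r.
Proof.
move=> AX Aq Ar Am /andP[l0 l1] cn.
have [[Xq Xr] Xm] := (AX _ Aq, AX _ Ar, AX _ Am).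
have D0 := metric_ge0 Xq Xr.
have h1 : d q m <= l * d q r.
  apply: ler_of_sqr; first exact: mulr_ge0.
  by have := cn _ Aq; rewrite metric_refl // expr0n /= ; nra.
have h2 : d m r <= (1 - l) * d q r.
  apply: ler_of_sqr; first by apply: mulr_ge0 => //; lra.
  rewrite (metric_sym Xm Xr).
  have := cn _ Ar; rewrite metric_refl // (metric_sym Xr Xq) expr0n /= ; nra.
by have tri := metric_tri Xq Xm Xr; split; lra.
Qed.

(** For the test point [m], the right-hand side at the true CN point [n] is zero, which forces
    [m = n]. So being a CN point can be read off from two distances. *)
Lemma cn_point_unique A q r (l : R) m : A `<=` X -> cn_space A -> A q -> A r -> A m ->
  0 <= l <= 1 -> d q m = l * d q r -> d m r = (1 - l) * d q r -> cn_point A q r l m.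
Proof.
move=> AX PA Aq Ar Am l01 h1 h2.
have [n An cn] := PA _ _ _ Aq Ar l01.
suff -> : m = n by [].
have [[Xq Xr] Xm] := (AX _ Aq, AX _ Ar, AX _ Am).
apply: metric_eq0 => //; first exact: AX.
have := cn _ Am; rewrite (metric_sym Xm Xq) h1 h2 => h.
have : d m n ^+ 2 <= 0 by nra.
by rewrite le_eqVlt ltNge sqr_ge0 orbF sqrf_eq0 => /eqP.
Qed.

Lemma cn_stewart A p q m r : A `<=` X -> cn_space A -> A p -> A q -> A m -> A r ->
  d q m + d m r = d q r -> stewart p q m r.
Proof.
move=> AX PA Ap Aq Am Ar h; rewrite /stewart.
have [[[Xp Xq] Xr] Xm] := (AX _ Ap, AX _ Aq, AX _ Ar, AX _ Am).
have a0 := metric_ge0 Xq Xm; have b0 := metric_ge0 Xm Xr.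
have [D0|D0] := eqVneq (d q r) 0.
  have [qm mr] : d q m = 0 /\ d m r = 0 by lra.
  by rewrite qm mr; lra.
have Dp : 0 < d q r by rewrite lt_neqAle eq_sym D0 metric_ge0.
have l01 : 0 <= d q m / d q r <= 1.
  by rewrite divr_ge0 ?metric_ge0 //= ler_pdivrMr // mul1r; lra.
have := cn_point_unique AX PA Aq Ar Am l01 _ _.
rewrite mulfVK // => /(_ erefl); rewrite mulrBl mulfVK // mul1r.
have -> : d m r = d q r - d q m by lra.
move=> /(_ erefl p Ap).
set a := d q m; set D := d q r in Dp D0 *; set P := d p m ^+ 2.
set Q := d p q ^+ 2; set S := d p r ^+ 2 => hh.
have : D * P <= D * ((1 - a / D) * Q + a / D * S - a / D * (1 - a / D) * D ^+ 2).
  by rewrite ler_pM2l.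
have -> : D * ((1 - a / D) * Q + a / D * S - a / D * (1 - a / D) * D ^+ 2) =
   (D - a) * Q + a * S - a * (D - a) * D by field.
nra.
Qed.

(* Reshetnyak's quadrilateral inequality; the product 2 d23 d14 is replaced by
   its AM-GM bounds, of which only one value of t is needed later. *)
Lemma cn_quadrilateral A x1 x2 x3 x4 (t : R) : A `<=` X -> cn_space A ->
  A x1 -> A x2 -> A x3 -> A x4 -> 0 < t ->
  d x1 x3 ^+ 2 + d x2 x4 ^+ 2 <=
  d x1 x2 ^+ 2 + d x3 x4 ^+ 2 + t * d x2 x3 ^+ 2 + d x1 x4 ^+ 2 / t.
Proof.
move=> AX PA A1 A2 A3 A4 t0.
have [[[X1 X2] X3] X4] := (AX _ A1, AX _ A2, AX _ A3, AX _ A4).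
(* The inequalities at [x2] and [x4] will be multiplied by [1 + t] and [(1 + t) / t]; with this
   ratio [d x1 x3 ^+ 2] then receives the coefficients [t / (1 + t)] and [1 / (1 + t)], which add up
   to 1. *)
have l01 : 0 <= t / (1 + t) <= 1.
  by rewrite divr_ge0 /= ?ler_pdivrMr; lra.
have [n An cn] := PA _ _ _ A1 A3 l01.
have Xn := AX _ An.
have h2 := cn _ A2; have h4 := cn _ A4; have tri := metric_tri X2 Xn X4.
move: h2 h4 tri.
rewrite (metric_sym Xn X4) (metric_sym X2 X1) (metric_sym X4 X1) (metric_sym X4 X3).
have n0 := metric_ge0 X2 Xn; have n1 := metric_ge0 X4 Xn; have n2 := metric_ge0 X2 X4.
move: (d x2 n) (d x4 n) (d x2 x4) n0 n1 n2 (d x1 x2) (d x1 x3) (d x1 x4) (d x2 x3) (d x3 x4).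
move=> u v w u0 v0 w0 e12 e13 e14 e23 e34 h2 h4 tri.
have hw : w ^+ 2 <= (1 + t) * u ^+ 2 + (1 + t) / t * v ^+ 2.
  have e : (1 + t) * u ^+ 2 + (1 + t) / t * v ^+ 2 = (u + v) ^+ 2 + (t * u - v) ^+ 2 / t.
    by field; lra.
  rewrite e; have : 0 <= (t * u - v) ^+ 2 / t by rewrite divr_ge0 ?sqr_ge0 ?ltW.
  nra.
have k2 : (1 + t) * u ^+ 2 <= (1 + t) *
    ((1 - t / (1 + t)) * e12 ^+ 2 + t / (1 + t) * e23 ^+ 2 - t / (1 + t) * (1 - t / (1 + t)) * e13 ^+ 2).
  by rewrite ler_pM2l //; lra.
have k4 : (1 + t) / t * v ^+ 2 <= (1 + t) / t *
    ((1 - t / (1 + t)) * e14 ^+ 2 + t / (1 + t) * e34 ^+ 2 - t / (1 + t) * (1 - t / (1 + t)) * e13 ^+ 2).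
  by rewrite ler_pM2l // divr_gt0 //; lra.
have e2 : (1 + t) * ((1 - t / (1 + t)) * e12 ^+ 2 + t / (1 + t) * e23 ^+ 2 - t / (1 + t) * (1 - t / (1 + t)) * e13 ^+ 2)
  = e12 ^+ 2 + t * e23 ^+ 2 - t / (1 + t) * e13 ^+ 2 by field; lra.
have e4 : (1 + t) / t * ((1 - t / (1 + t)) * e14 ^+ 2 + t / (1 + t) * e34 ^+ 2 - t / (1 + t) * (1 - t / (1 + t)) * e13 ^+ 2)
  = e14 ^+ 2 / t + e34 ^+ 2 - 1 / (1 + t) * e13 ^+ 2 by field; lra.
have e5 : t / (1 + t) * e13 ^+ 2 + 1 / (1 + t) * e13 ^+ 2 = e13 ^+ 2 by field; lra.
lra.
Qed.

Lemma le0_small_multiple (K M : R) : 0 <= M ->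
  (forall u : R, 0 < u <= 1 -> K <= u * M) -> K <= 0.
Proof.
move=> M0 h; rewrite leNgt; apply/negP => K0.
have D0 : 0 < 2 * K + M by lra.
have : 0 < K / (2 * K + M) <= 1 by rewrite divr_gt0 //= ler_pdivrMr //; lra.
move=> /h; rewrite mulrAC ler_pdivlMr //; nra.
Qed.

(** Both pieces live in one metric space, so they induce the same metric on [C]. The field
    [glue_through] plays the part of the quotient metric in the classical theorem. *)
Record gluing (A B C : set T) : Prop := Gluing {
  glue_subl : A `<=` X; glue_subr : B `<=` X;
  glue_cnl : cn_space A; glue_cnr : cn_space B;
  glue_cutl : C `<=` A; glue_cutr : C `<=` B;
  glue_convex : forall c c' (l : R), C c -> C c' -> 0 <= l <= 1 ->
    exists m, [/\ C m, d c m = l * d c c' & d m c' = (1 - l) * d c c'];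
  glue_through : forall x y, A x -> B y -> exists2 c, C c & d x y = d x c + d c y }.

Lemma gluing_sym A B C : gluing A B C -> gluing B A C.
Proof.
case=> AX BX PA PB CA CB cvx thru; split=> // x y Bx Ay.
have [c Cc e] := thru y x Ay Bx; exists c => //.
have Xc := AX _ (CA _ Cc).
by rewrite (metric_sym (BX _ Bx) (AX _ Ay)) e addrC (metric_sym Xc (BX _ Bx)) (metric_sym Xc (AX _ Ay)).
Qed.

Section GluingLemmas.
Variables (A B C : set T).
Hypothesis hg : gluing A B C.

Let AX := glue_subl hg.
Let BX := glue_subr hg.
Let CA := glue_cutl hg.
Let CB := glue_cutr hg.

(** The point of [C] given by convexity has the right distances, so uniqueness makes it the CN point
    of both pieces at once. *)
Lemma glue_convex_cn c c' (l : R) : C c -> C c' -> 0 <= l <= 1 ->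
  exists m, [/\ C m, cn_point A c c' l m & cn_point B c c' l m].
Proof.
move=> Cc Cc' l01; have [m [Cm e1 e2]] := glue_convex hg Cc Cc' l01; exists m; split=> //.
- by apply: (cn_point_unique AX (glue_cnl hg)) => //; exact: CA.
- by apply: (cn_point_unique BX (glue_cnr hg)) => //; exact: CB.
Qed.

(* First variation at o along the segment [o,c], of which C contains all points. *)
Lemma glue_stewart_cut q r o c : A q -> B r -> C o -> C c ->
  d q o + d o r = d q r -> 0 < d q o -> 0 < d o r -> stewart c q o r.
Proof.
move=> Aq Br Co Cc e a0 b0; rewrite /stewart.
have [[[Xq Xr] Xo] Xc] := (AX Aq, BX Br, AX (CA Co), AX (CA Cc)).
rewrite (metric_sym Xc Xo) (metric_sym Xc Xq).
set K := _ + _; rewrite -subr_le0; set L := (X in _ - X).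
apply: (@le0_small_multiple _ ((d q o + d o r) * d o c ^+ 2)).
  by rewrite mulr_ge0 ?sqr_ge0 //; lra.
move=> u /andP[u0 u1].
have u01 : 0 <= u <= 1 by rewrite ltW.
have [m [Cm cA cB]] := glue_convex_cn Co Cc u01.
have Xm := AX (CA Cm).
have hq := cA _ Aq; have hr := cB _ Br; have tri := metric_tri Xq Xm Xr.
move: hq hr tri; rewrite -e /K /L (metric_sym Xr Xm) (metric_sym Xr Xo) (metric_sym Xr Xc).
have m0 := metric_ge0 Xq Xm; have m1 := metric_ge0 Xm Xr.
move: (d q m) (d m r) (d q o) (d o r) (d o c) (d q c) (d c r) a0 b0 m0 m1 => {K L}.
move=> s t a b f y z a0 b0 s0 t0 hq hr tri.
(* Linearising the squares at [a] and [b] makes them comparable with the triangle inequality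
   [a + b <= s + t]; the weights [b] and [a] turn both linear terms into multiples of [a * b]. *)
have k1 : 2 * a * s <= s ^+ 2 + a ^+ 2 by have := sqr_ge0 (s - a); nra.
have k2 : 2 * b * t <= t ^+ 2 + b ^+ 2 by have := sqr_ge0 (t - b); nra.
have k3 : 2 * (a * b) * (a + b) <= b * (2 * a * s) + a * (2 * b * t).
  have : a * b * (a + b) <= a * b * (s + t) by rewrite ler_pM2l // mulr_gt0.
  lra.
have k4 : b * (2 * a * s) <= b * (s ^+ 2 + a ^+ 2) by rewrite ler_pM2l.
have k5 : a * (2 * b * t) <= a * (t ^+ 2 + b ^+ 2) by rewrite ler_pM2l.
have k6 : b * s ^+ 2 <= b * ((1 - u) * a ^+ 2 + u * y ^+ 2 - u * (1 - u) * f ^+ 2).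
  by rewrite ler_pM2l.
have k7 : a * t ^+ 2 <= a * ((1 - u) * b ^+ 2 + u * z ^+ 2 - u * (1 - u) * f ^+ 2).
  by rewrite ler_pM2l.
rewrite -(ler_pM2l u0); lra.
Qed.

(* Case p, q in A and r in B: [p,r] crosses C at c. With y = |pc|, z = |cr| and
   ph the point of [o,p] at fraction z/(y+z), the claim is a linear combination of
   the inequality at c, of the CN inequalities at ph and of the quadrilateral
   inequality for q, ph, c, o, whose AM-GM parameter is a(y+z)/(yb). *)
Lemma glue_stewart_crossing p q r o : A p -> A q -> B r -> C o ->
  d q o + d o r = d q r -> 0 < d q o -> 0 < d o r -> stewart p q o r.
Proof.
move=> Ap Aq Br Co e a0 b0.
have Ao := CA Co.
have [[[Xp Xq] Xr] Xo] := (AX Ap, AX Aq, BX Br, AX Ao).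
have [c Cc ec] := glue_through hg Ap Br.
have Ac := CA Cc; have Xc := AX Ac.
have [z0|zn] := eqVneq (d c r) 0.
  have rc : r = c by apply/esym/(metric_eq0 Xc Xr).
  rewrite rc in e *; exact: (cn_stewart AX (glue_cnl hg)).
have [y0|yn] := eqVneq (d p c) 0.
  have -> : p = c by exact: (metric_eq0 Xp Xc).
  exact: glue_stewart_cut.
have z0 : 0 < d c r by rewrite lt_neqAle eq_sym zn metric_ge0.
have y0 : 0 < d p c by rewrite lt_neqAle eq_sym yn metric_ge0.
have yz0 : 0 < d p c + d c r by lra.
have s01 : 0 <= d c r / (d p c + d c r) <= 1.
  by rewrite divr_ge0 ?ler_pdivrMr //=; lra.
have [ph Aph cn] := glue_cnl hg Ao Ap s01.
have Xph := AX Aph.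
have [dist _] := cn_point_dist AX Ao Ap Aph s01 cn.
have hq := cn _ Aq; have hc := cn _ Ac.
have six := glue_stewart_cut Aq Br Co Cc e a0 b0.
have t0 : 0 < d q o * (d p c + d c r) / (d p c * d o r).
  by rewrite divr_gt0 // mulr_gt0.
have quad := cn_quadrilateral AX (glue_cnl hg) Aq Aph Ac Ao t0.
move: hq hc six quad; rewrite /stewart ec.
rewrite (metric_sym Xph Xo) dist (metric_sym Xc Xo) (metric_sym Xc Xq) (metric_sym Xq Xp).
rewrite (metric_sym Xc Xp) (metric_sym Xph Xc) (metric_sym Xp Xo).
move: (d c r) (d p c) (d q o) (d o r) z0 y0 yz0 a0 b0 => z y a b z0 y0 yz0 a0 b0.
move: (d o p) (d o c) (d q c) (d q ph) (d c ph) (d p q) => x f g u v w.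
clear -z0 y0 yz0 a0 b0.
move=> hq hc six quad.
have [s0 t0] : 0 <= (y + z) / z /\ 0 <= a * (y + z) / (y * b).
  by split; apply: divr_ge0; rewrite ?mulr_ge0 //; lra.
have bs0 : 0 <= b * ((y + z) / z) by rewrite mulr_ge0 // ltW.
have bst0 : 0 <= b * ((y + z) / z) * (a * (y + z) / (y * b)) by rewrite mulr_ge0.
rewrite -subr_ge0 in hq; rewrite -subr_ge0 in hc; rewrite -subr_ge0 in six.
rewrite -subr_ge0 in quad; rewrite -subr_ge0.
(* These weights cancel the unknown distances from [ph] to [q] and to [c], which the quadrilateral
   inequality introduces and the two CN inequalities at [ph] bound. *)
have := addr_ge0 (addr_ge0 (mulr_ge0 s0 six) (mulr_ge0 bs0 quad))
                 (addr_ge0 (mulr_ge0 bs0 hq) (mulr_ge0 bst0 hc)).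
congr (0 <= _); field.
by rewrite !gt_eqF.
Qed.

(* [m,p] crosses C at o <> m: combine the crossing inequality at o for the triangles
   q, m, p and r, m, p with the inequality at m for o in A. *)
Lemma glue_stewart_off_cut p q m r : B p -> A q -> A m -> A r ->
  d q m + d m r = d q r -> ~ C m -> stewart p q m r.
Proof.
move=> Bp Aq Am Ar e nCm; rewrite /stewart.
have [o Co eo] := glue_through hg Am Bp; have Ao := CA Co.
have [[[Xp Xq] Xr] Xm] := (BX Bp, AX Aq, AX Ar, AX Am).
have Xo := AX Ao.
have b0 : 0 < d m o.
  rewrite lt_neqAle eq_sym metric_ge0 // andbT; apply/eqP => /(metric_eq0 Xm Xo) mo.
  by apply: nCm; rewrite mo.
have [a0|an] := eqVneq (d o p) 0.
  have po : p = o by exact/esym/(metric_eq0 Xo Xp).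
  by apply: (cn_stewart AX (glue_cnl hg)) => //; rewrite po.
have a0 : 0 < d o p by rewrite lt_neqAle eq_sym an metric_ge0.
have sq := glue_stewart_crossing Aq Am Bp Co (esym eo) b0 a0.
have sr := glue_stewart_crossing Ar Am Bp Co (esym eo) b0 a0.
have so := cn_stewart AX (glue_cnl hg) Ao Aq Am Ar e.
move: sq sr so; rewrite /stewart (metric_sym Xp Xm) (metric_sym Xo Xm) (metric_sym Xo Xq).
rewrite (metric_sym Xo Xr) (metric_sym Xp Xq) (metric_sym Xp Xr) (metric_sym Xr Xm) eo.
have h1 := metric_ge0 Xq Xm; have h2 := metric_ge0 Xm Xr.
move: (d m o) (d o p) (d q m) (d m r) b0 a0 h1 h2 => b a s t b0 a0 s0 t0.
move=> sq sr so.
have k1 := ler_wpM2l t0 sq; have k2 := ler_wpM2l s0 sr.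
have ab0 : 0 <= a + b by lra.
have k3 := ler_wpM2l ab0 so.
rewrite -(ler_pM2l b0); lra.
Qed.

End GluingLemmas.

(** At the supremum of the points where [G <= 0], continuity still gives [G <= 0]; just to its right
    [G] is positive and, by the Lipschitz bound, small. *)
Lemma lipschitz_small_value (G : R -> R) (K t e : R) : 0 <= K -> 0 < t -> 0 < e ->
  (forall s u : R, 0 <= s <= t -> 0 <= u <= t -> G u <= G s + K * `|s - u|) ->
  G 0 <= 0 -> 0 < G t -> exists u, [/\ 0 <= u < t, 0 < G u & G u <= e].
Proof.
move=> K0 t0 e0 lip G0 Gt.
pose S := [set s : R | 0 <= s <= t /\ G s <= 0].
have S0 : S 0 by split=> //; rewrite lexx ltW.
have ubS : ubound S t by move=> s [/andP[]].
have hS : has_sup S by split; [exists 0 | exists t].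
set u := sup S.
have u0 : 0 <= u by apply: ub_le_sup => //; exists t.
have ut : u <= t by apply: ge_sup => //; exists 0.
have Gu : G u <= 0.
  apply: (@le0_small_multiple _ K) => // x /andP[x0 x1].
  have [s Ss sx] := sup_adherent x0 hS.
  have [s0t Gs] := Ss.
  have su : s <= u by apply: ub_le_sup => //; exists t.
  have := lip s u s0t _; rewrite u0 ut => /(_ isT).
  rewrite ler0_norm ?subr_le0 // -/u in sx *; nra.
have {ut} ut : u < t.
  by rewrite lt_neqAle ut andbT; apply/eqP => ut'; rewrite ut' in Gu; lra.
have tu0 : 0 < t - u by lra.
have [D [D0 Dt KD]] : exists D, [/\ 0 < D, D < t - u & K * D <= e].
  have N0 : 0 < 2 * e + K * (t - u) by have := mulr_ge0 K0 (ltW tu0); lra.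
  (* Half the harmonic-type mean of [t - u] and [e / K], up to constants: one formula that is below
     both bounds and also makes sense for [K = 0]. *)
  exists ((t - u) * e / (2 * e + K * (t - u))); split.
  - by rewrite divr_gt0 // mulr_gt0.
  - by rewrite ltr_pdivrMr // ltr_pM2l //; have := mulr_ge0 K0 (ltW tu0); lra.
  - by rewrite mulrA ler_pdivrMr //; nra.
exists (u + D); split; first by apply/andP; split; lra.
- rewrite ltNge; apply/negP => h.
  have : S (u + D) by split => //; apply/andP; split; lra.
  by move=> /(ub_le_sup _) => /(_ (ex_intro _ t ubS)); rewrite -/u; lra.
- have : G (u + D) <= G u + K * `|u - (u + D)| by apply: lip; apply/andP; split; lra.
  rewrite (_ : u - (u + D) = - D); last by ring.
  by rewrite normrN gtr0_norm //; lra.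
Qed.

(** If [G t > 0], there are parameters on both sides of [t] where [G] is positive but at most
    [G t / 2]. Positivity places all three in [Z], and convexity there contradicts the value at
    [t]. *)
Lemma lipschitz_convex_le0 (G : R -> R) (K : R) (Z : set R) : 0 <= K ->
  (forall s t : R, 0 <= s <= 1 -> 0 <= t <= 1 -> G t <= G s + K * `|s - t|) ->
  G 0 <= 0 -> G 1 <= 0 ->
  (forall t : R, 0 <= t <= 1 -> ~ Z t -> G t <= 0) ->
  (forall u t v : R, 0 <= u -> u < t -> t < v -> v <= 1 -> Z u -> Z t -> Z v ->
     (v - u) * G t <= (v - t) * G u + (t - u) * G v) ->
  forall t : R, 0 <= t <= 1 -> G t <= 0.
Proof.
move=> K0 lip G0 G1 off cvx t t01; rewrite leNgt; apply/negP => Gt.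
have /andP[t0 t1] := t01.
have tp : 0 < t by rewrite lt_neqAle t0 andbT; apply/eqP => e; rewrite -e in Gt; lra.
have tp1 : t < 1 by rewrite lt_neqAle t1 andbT; apply/eqP => e; rewrite e in Gt; lra.
have e0 : 0 < G t / 2 by lra.
have Zpos s : 0 <= s <= 1 -> 0 < G s -> Z s.
  by move=> s01 Gs; apply: contrapT => nZ; have := off s s01 nZ; lra.
have lipl s s' : 0 <= s <= t -> 0 <= s' <= t -> G s' <= G s + K * `|s - s'|.
  by move=> /andP[? ?] /andP[? ?]; apply: lip; apply/andP; split; lra.
have [u [/andP[u0 ut] Gu Gue]] := lipschitz_small_value K0 tp e0 lipl G0 Gt.
have tq : 0 < 1 - t by lra.
have lipr s s' : 0 <= s <= 1 - t -> 0 <= s' <= 1 - t ->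
    G (1 - s') <= G (1 - s) + K * `|s - s'|.
  move=> /andP[? ?] /andP[? ?]; rewrite -normrN (_ : - (s - s') = (1 - s) - (1 - s')); last by ring.
  by apply: lip; apply/andP; split; lra.
have Gr0 : G (1 - 0) <= 0 by rewrite subr0.
have Grt : 0 < G (1 - (1 - t)) by rewrite (_ : 1 - (1 - t) = t) //; ring.
have [v [/andP[v0 vt] Gv Gve]] := lipschitz_small_value (G := fun s => G (1 - s)) K0 tq e0 lipr Gr0 Grt.
have := cvx u t (1 - v) u0 ut _ _; rewrite ltrBrDl -ltrBrDr vt => /(_ isT).
have -> : 1 - v <= 1 by lra.
move=> /(_ isT) h.
have := h (Zpos _ _ Gu) (Zpos _ t01 Gt) (Zpos _ _ Gv).
move=> /(_ ltac:(apply/andP; split; lra) ltac:(apply/andP; split; lra)).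
have vu : 0 < (1 - v) - u by lra.
have a1 : (1 - v - t) * G u <= (1 - v - t) * (G t / 2) by rewrite ler_wpM2l //; lra.
have a2 : (t - u) * G (1 - v) <= (t - u) * (G t / 2) by rewrite ler_wpM2l //; lra.
have : 0 < (1 - v - u) * (G t / 2) by rewrite mulr_gt0.
lra.
Qed.

(** The CN inequality of [n] with test point [m] gives the upper bound, the triangle inequality
    through [q] the lower one; hence CN points of varying ratio trace a geodesic. *)
Lemma cn_curve_dist A q r (s t : R) m n : A `<=` X -> A q -> A r -> A m -> A n ->
  0 <= s <= 1 -> 0 <= t <= 1 -> cn_point A q r s m -> cn_point A q r t n -> s <= t ->
  d m n = (t - s) * d q r.
Proof.
move=> AX Aq Ar Am An s01 t01 cm cn st.
have [[[Xq Xr] Xm] Xn] := (AX _ Aq, AX _ Ar, AX _ Am, AX _ An).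
have [m1 m2] := cn_point_dist AX Aq Ar Am s01 cm.
have [n1 n2] := cn_point_dist AX Aq Ar An t01 cn.
have D0 := metric_ge0 Xq Xr.
apply/eqP; rewrite eq_le; apply/andP; split.
  apply: ler_of_sqr; first by rewrite mulr_ge0 //; lra.
  have := cn _ Am; rewrite (metric_sym Xm Xq) m1 m2; nra.
have := metric_tri Xq Xm Xn; rewrite m1 n1; lra.
Qed.

(* For p in B the crossing argument covers the points of [q,r] outside C, and the part
   of [q,r] inside C is a geodesic of B; continuity joins the two. *)
Lemma glue_cn_point_extend A B C q r (l : R) m : gluing A B C -> A q -> A r -> A m ->
  0 <= l <= 1 -> cn_point A q r l m -> cn_point (A `|` B) q r l m.
Proof.
move=> hg Aq Ar Am l01 cnm p [Ap|Bp]; first exact: cnm.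
have AX := glue_subl hg; have BX := glue_subr hg.
have [[[Xq Xr] Xm] Xp] := (AX _ Aq, AX _ Ar, AX _ Am, BX _ Bp).
have D0 := metric_ge0 Xq Xr.
have [D00|Dn] := eqVneq (d q r) 0.
  have [m1 _] := cn_point_dist AX Aq Ar Am l01 cnm.
  rewrite D00 mulr0 in m1.
  by rewrite -(metric_eq0 Xq Xm m1) -(metric_eq0 Xq Xr D00) metric_refl //; lra.
have Dp : 0 < d q r by rewrite lt_neqAle eq_sym Dn.
have /choice [g gP] : forall t : R, exists m, 0 <= t <= 1 -> A m /\ cn_point A q r t m.
  move=> t; case: (boolP (0 <= t <= 1)) => [t01|_]; last by exists q.
  by have [n An cn] := glue_cnl hg Aq Ar t01; exists n.
have gd (s t : R) : 0 <= s <= 1 -> 0 <= t <= 1 -> s <= t -> d (g s) (g t) = (t - s) * d q r.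
  move=> s01 t01; have [As cs] := gP s s01; have [At ct] := gP t t01.
  exact: (cn_curve_dist AX).
have ml : m = g l.
  have [Al cl] := gP l l01; apply: metric_eq0 => //; first exact: AX.
  by rewrite (cn_curve_dist AX Aq Ar Am Al l01 l01 cnm cl) // subrr mul0r.
pose G (t : R) := d p (g t) ^+ 2 -
  ((1 - t) * d p q ^+ 2 + t * d p r ^+ 2 - t * (1 - t) * d q r ^+ 2).
suff : G l <= 0 by rewrite /G subr_le0 -ml.
pose M := d p q + d q r.
have Xg (t : R) : 0 <= t <= 1 -> X (g t) by move=> t01; apply: AX; have [] := gP t t01.
have g0 : g 0 = q.
  have h : 0 <= (0 : R) <= 1 by apply/andP; split; lra.
  have [Ag cg] := gP 0 h; have [e _] := cn_point_dist AX Aq Ar Ag h cg.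
  by apply/esym/(metric_eq0 Xq (Xg _ h)); rewrite e mul0r.
have g1 : g 1 = r.
  have h : 0 <= (1 : R) <= 1 by apply/andP; split; lra.
  have [Ag cg] := gP 1 h; have [_ e] := cn_point_dist AX Aq Ar Ag h cg.
  by apply/(metric_eq0 (Xg _ h) Xr); rewrite e subrr mul0r.
have dpq := metric_ge0 Xp Xq; have dpr := metric_ge0 Xp Xr.
have bM (t : R) : 0 <= t <= 1 -> d p (g t) <= M.
  move=> /[dup] t01 /andP[t0 t1]; have h : 0 <= (0 : R) <= 1 by apply/andP; split; lra.
  have := metric_tri Xp Xq (Xg _ t01); rewrite -{2}g0 (gd 0 t h t01 t0) subr0 /M; nra.
have lipd (s t : R) : 0 <= s <= 1 -> 0 <= t <= 1 -> `|d p (g t) - d p (g s)| <= `|s - t| * d q r.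
  move=> s01 t01; have t1 := metric_tri Xp (Xg _ s01) (Xg _ t01).
  have t2 := metric_tri Xp (Xg _ t01) (Xg _ s01).
  have [st|ts] := leP s t.
    rewrite (metric_sym (Xg _ t01) (Xg _ s01)) (gd s t) // in t1 t2.
    by rewrite ler_norml ler0_norm; [apply/andP; split; lra|lra].
  rewrite (metric_sym (Xg _ s01) (Xg _ t01)) (gd t s) // in t1 t2; try exact: ltW.
  by rewrite ler_norml gtr0_norm; [apply/andP; split; lra|lra].
(* The first summand controls the squared distance, whose root stays below [M]; the other three
   control the quadratic comparison function. *)
apply: (@lipschitz_convex_le0 G (d q r * (2 * M) + d p q ^+ 2 + d p r ^+ 2 + d q r ^+ 2)
  [set t : R | C (g t)]) => //.
- by rewrite !addr_ge0 ?sqr_ge0 // mulr_ge0 // /M; lra.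
- move=> s t s01 t01; rewrite /G.
  have b1 := bM s s01; have b2 := bM t t01.
  have c1 := metric_ge0 Xp (Xg _ s01); have c2 := metric_ge0 Xp (Xg _ t01).
  have li := lipd s t s01 t01.
  have n0 : 0 <= `|s - t| by [].
  have k1 : d p (g t) ^+ 2 - d p (g s) ^+ 2 <= `|s - t| * d q r * (2 * M).
    rewrite subr_sqr; apply: (le_trans (ler_norm _)); rewrite normrM.
    by apply: ler_pM => //; rewrite ger0_norm; lra.
  have [i1 i2] : s - t <= `|s - t| /\ t - s <= `|s - t|.
    by split; rewrite ?ler_norm // distrC ler_norm.
  have k2 : (t - s) * d p q ^+ 2 <= `|s - t| * d p q ^+ 2 by rewrite ler_wpM2r ?sqr_ge0.
  have k3 : (s - t) * d p r ^+ 2 <= `|s - t| * d p r ^+ 2 by rewrite ler_wpM2r ?sqr_ge0.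
  have k4 : (t - s) * (1 - t - s) * d q r ^+ 2 <= `|s - t| * d q r ^+ 2.
    rewrite ler_wpM2r ?sqr_ge0 //; apply: (le_trans (ler_norm _)).
    rewrite normrM distrC ler_piMr // ler_norml.
    by move/andP: s01 => [? ?]; move/andP: t01 => [? ?]; apply/andP; split; lra.
  lra.
- by rewrite /G g0; lra.
- by rewrite /G g1; lra.
- move=> t t01 nC; rewrite /G subr_le0.
  have [At ct] := gP t t01; have [e1 e2] := cn_point_dist AX Aq Ar At t01 ct.
  have e : d q (g t) + d (g t) r = d q r by rewrite e1 e2; ring.
  have := glue_stewart_off_cut hg Bp Aq At Ar e nC; rewrite /stewart e e1 e2 => h.
  by rewrite -(ler_pM2l Dp); lra.
(* Points of the curve in [C] lie on a geodesic of [B], so the inequality of [B] applies;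
   subtracting the comparison function turns it into convexity of [G]. *)
- move=> u t v u0 ut tv v1 Cu Ct Cv.
  have u01 : 0 <= u <= 1 by apply/andP; split; lra.
  have t01 : 0 <= t <= 1 by apply/andP; split; lra.
  have v01 : 0 <= v <= 1 by apply/andP; split; lra.
  have CB := glue_cutr hg.
  have eut : d (g u) (g t) = (t - u) * d q r by apply: gd => //; lra.
  have etv : d (g t) (g v) = (v - t) * d q r by apply: gd => //; lra.
  have euv : d (g u) (g v) = (v - u) * d q r by apply: gd => //; lra.
  have e : d (g u) (g t) + d (g t) (g v) = d (g u) (g v) by rewrite eut etv euv; ring.
  have := cn_stewart BX (glue_cnr hg) Bp (CB _ Cu) (CB _ Ct) (CB _ Cv) e.
  rewrite /stewart e eut etv euv /G => h.
  by rewrite -(ler_pM2l Dp); lra.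
Qed.

(** The point is taken on [[q,o]], at the ratio rescaled by [d q r / d q o]. Its CN inequality on
    [[q,o]] bounds it by the distance to [o], and Stewart's inequality at [o] on [[q,r]] removes
    that distance. *)
Lemma glue_cn_point_left A B C q r o (l : R) : gluing A B C -> A q -> B r -> C o ->
  d q r = d q o + d o r -> 0 <= l <= 1 -> l * d q r <= d q o ->
  exists2 m, A m & cn_point (A `|` B) q r l m.
Proof.
move=> hg Aq Br Co e l01 le.
have AX := glue_subl hg; have BX := glue_subr hg.
have Ao := glue_cutl hg Co.
have [[Xq Xr] Xo] := (AX _ Aq, BX _ Br, AX _ Ao).
have [a0 b0] := (metric_ge0 Xq Xo, metric_ge0 Xo Xr).
have D0 := metric_ge0 Xq Xr; have /andP[l0 l1] := l01.
have XAB p : (A `|` B) p -> X p by case=> [/AX|/BX].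
have [a00|an] := eqVneq (d q o) 0.
  exists q => // p Ap; have Xp := XAB _ Ap.
  have : l * d q r = 0 by apply/eqP; rewrite eq_le mulr_ge0 // andbT -a00.
  move=> /eqP; rewrite mulf_eq0 => /orP[/eqP ->|/eqP D00]; first by lra.
  by rewrite -(metric_eq0 Xq Xr D00) metric_refl //; lra.
have ap : 0 < d q o by rewrite lt_neqAle eq_sym an.
have k01 : 0 <= l * d q r / d q o <= 1.
  by rewrite divr_ge0 ?mulr_ge0 //= ler_pdivrMr // mul1r.
have [m Am cnm] := glue_cnl hg Aq Ao k01; exists m => // p ABp.
have := glue_cn_point_extend hg Aq Ao Am k01 cnm ABp.
have Xp := XAB _ ABp.
(* A test point in [A] shares its side with [q], one in [B] with [r]; the second case is the
   crossing inequality with the two pieces exchanged. *)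
have so : stewart p q o r.
  have [b00|bn] := eqVneq (d o r) 0.
    by rewrite /stewart b00 (metric_eq0 Xo Xr b00); lra.
  have bp : 0 < d o r by rewrite lt_neqAle eq_sym bn.
  case: ABp => [Ap|Bp]; first exact: (glue_stewart_crossing hg).
  have hg' := gluing_sym hg.
  have : stewart p r o q.
    apply: (glue_stewart_crossing hg') => //.
    - by rewrite (metric_sym Xr Xo) (metric_sym Xo Xq) (metric_sym Xr Xq) e addrC.
    - by rewrite metric_sym.
    - by rewrite metric_sym.
  rewrite /stewart (metric_sym Xr Xo) (metric_sym Xo Xq); lra.
move: so; rewrite /stewart e.
rewrite e in le D0 k01 *.
move: (d q o) (d o r) ap b0 => a b ap b0.
move: (d p m) (d p q) (d p o) (d p r) => w x y z so h.
apply: (le_trans h).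
have D1 : 0 < a + b by lra.
set k := l * (a + b) / a.
have kE : l = k * a / (a + b) by rewrite /k; field; rewrite !gt_eqF.
have k0 : 0 <= k by rewrite /k divr_ge0 ?mulr_ge0 // ltW.
have hk := ler_wpM2l k0 so; rewrite -(ler_pM2l D1).
have -> : (a + b) * ((1 - l) * x ^+ 2 + l * z ^+ 2 - l * (1 - l) * (a + b) ^+ 2) =
  (a + b - k * a) * x ^+ 2 + k * a * z ^+ 2 - k * a * (a + b - k * a) * (a + b).
  by rewrite kE; field; rewrite gt_eqF.
lra.
Qed.

(** Ends on the same side use the extension of a CN point to the union. Ends on different sides use
    the crossing point [o]; a point beyond [o] is reached from the other end, at ratio [1 - l]. *)
Theorem glue_cn_space A B C : gluing A B C -> cn_space (A `|` B).
Proof.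
move=> hg.
have AX := glue_subl hg; have BX := glue_subr hg; have hg' := gluing_sym hg.
have mixed A' B' C' q r (l : R) : gluing A' B' C' -> A' q -> B' r -> 0 <= l <= 1 ->
    exists2 m, (A' `|` B') m & cn_point (A' `|` B') q r l m.
  move=> {AX BX} {}hg Aq Br l01; have AX := glue_subl hg; have BX := glue_subr hg.
  have [o Co e] := glue_through hg Aq Br.
  have Xo := AX _ (glue_cutl hg Co); have [Xq Xr] := (AX _ Aq, BX _ Br).
  have [le|lt] := leP (l * d q r) (d q o).
    by have [m Am cn] := glue_cn_point_left hg Aq Br Co e l01 le; exists m => //; left.
  have er : d r q = d r o + d o q.
    by rewrite (metric_sym Xr Xq) (metric_sym Xr Xo) (metric_sym Xo Xq) e addrC.
  have l01' : 0 <= 1 - l <= 1 by move/andP: l01 => [? ?]; apply/andP; split; lra.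
  have le' : (1 - l) * d r q <= d r o by rewrite (metric_sym Xr Xq) (metric_sym Xr Xo); lra.
  have [m Bm cn] := glue_cn_point_left (gluing_sym hg) Br Aq Co er l01' le'.
  exists m; first by right.
  by move=> p Ap; have := cn p; rewrite setUC => /(_ Ap); rewrite (metric_sym Xr Xq); lra.
move=> q r l [Aq|Bq] [Ar|Br] l01.
- have [m Am cn] := glue_cnl hg Aq Ar l01; exists m; first by left.
  exact: (glue_cn_point_extend hg).
- exact: mixed hg Aq Br l01.
- by rewrite setUC; exact: mixed hg' Bq Ar l01.
- have [m Bm cn] := glue_cnr hg Bq Br l01; exists m; first by right.
  by rewrite setUC; exact: (glue_cn_point_extend hg').
Qed.

End Gluing.

(** * Points of the cube complex and its path metric *)

Section SquareRoots.
Context {R : realType}.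
Implicit Types a b c e : R.

Lemma sqrt_le_of_sqr a b : 0 <= b -> a <= b ^+ 2 -> Num.sqrt a <= b.
Proof. by move=> b0 h; rewrite -(ger0_norm b0) -sqrtr_sqr ler_wsqrtr. Qed.

Lemma minkowski2 a b c e : 0 <= a -> 0 <= b -> 0 <= c -> 0 <= e ->
  Num.sqrt ((a + b) ^+ 2 + (c + e) ^+ 2) <=
  Num.sqrt (a ^+ 2 + c ^+ 2) + Num.sqrt (b ^+ 2 + e ^+ 2).
Proof.
move=> a0 b0 c0 e0; apply: sqrt_le_of_sqr; first by rewrite addr_ge0 ?sqrtr_ge0.
have A0 : 0 <= a ^+ 2 + c ^+ 2 by rewrite addr_ge0 ?sqr_ge0.
have B0 : 0 <= b ^+ 2 + e ^+ 2 by rewrite addr_ge0 ?sqr_ge0.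
have hA := sqr_sqrtr A0; have hB := sqr_sqrtr B0.
have sA := sqrtr_ge0 (a ^+ 2 + c ^+ 2); have sB := sqrtr_ge0 (b ^+ 2 + e ^+ 2).
rewrite [X in _ <= X]sqrrD hA hB.
suff : a * b + c * e <= Num.sqrt (a ^+ 2 + c ^+ 2) * Num.sqrt (b ^+ 2 + e ^+ 2) by lra.
apply: ler_of_sqr; first exact: mulr_ge0.
rewrite exprMn hA hB; have := sqr_ge0 (a * e - b * c); lra.
Qed.

Lemma minkowski2_norm a b c e : 0 <= a -> 0 <= b ->
  Num.sqrt ((a + b) ^+ 2 + (c + e) ^+ 2) <=
  Num.sqrt (a ^+ 2 + c ^+ 2) + Num.sqrt (b ^+ 2 + e ^+ 2).
Proof.
move=> a0 b0; rewrite -(real_normK (num_real c)) -(real_normK (num_real e)).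
rewrite -(real_normK (num_real (c + e))).
apply: le_trans (minkowski2 a0 b0 (normr_ge0 _) (normr_ge0 _)).
by apply: ler_wsqrtr; rewrite lerD2l ler_sqr ?nnegrE ?addr_ge0 // ler_normD.
Qed.

Lemma l2_triangle (I : Type) (S : list I) (f g h : I -> R) :
  Num.sqrt (\sum_(i <- S) (f i - h i) ^+ 2) <=
  Num.sqrt (\sum_(i <- S) (f i - g i) ^+ 2) + Num.sqrt (\sum_(i <- S) (g i - h i) ^+ 2).
Proof.
elim: S => [|i S IH]; first by rewrite !big_nil sqrtr0 addr0.
rewrite !big_cons.
have s0 (u v : I -> R) : 0 <= \sum_(i <- S) (u i - v i) ^+ 2.
  by apply: sumr_ge0 => j _; exact: sqr_ge0.
rewrite -(sqr_sqrtr (s0 f g)) -(sqr_sqrtr (s0 g h)) -{1}(sqr_sqrtr (s0 f h)).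
rewrite addrC [X in _ <= Num.sqrt X + _]addrC [X in _ <= _ + Num.sqrt X]addrC.
rewrite (_ : f i - h i = (f i - g i) + (g i - h i)); last by ring.
apply: le_trans (minkowski2_norm _ _ (sqrtr_ge0 _) (sqrtr_ge0 _)).
by apply: ler_wsqrtr; rewrite lerD2r ler_sqr ?nnegrE ?addr_ge0 ?sqrtr_ge0.
Qed.

End SquareRoots.

Section WallSpace.
Context {R : realType} {Y : Type}.
Variables (H : set (set Y)) (p : Y).
Hypothesis hW : space_with_walls H.
Implicit Types (x y z : set Y -> R) (h k w : set Y).

Lemma half_neq0 h : H h -> h !=set0.
Proof. by case: hW => _ + _ _; apply. Qed.

Lemma halfC h : H h -> H (~` h).
Proof. by case: hW => _ _ + _; apply. Qed.

Lemma neq_setC (h : set Y) : h <> ~` h.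
Proof.
move=> e; have : h p <-> ~ h p by rewrite {1}e.
by move=> [a b]; have np : ~ h p by [move=> hp; apply: a]; apply/np/b.
Qed.

(** Complementary half-spaces are excluded because both may carry positive weight inside a cube;
    equal ones are excluded by non-emptiness. *)
Definition disjoint_halves (h k : set Y) : Prop :=
  [/\ H h, H k, h `&` k = set0 & k <> ~` h].

Lemma disjoint_halves_sym h k : disjoint_halves h k -> disjoint_halves k h.
Proof. by case=> Hh Hk e n; split; rewrite 1?setIC // => e'; apply: n; rewrite e' setCK. Qed.

Lemma disjoint_halves_neq h k : disjoint_halves h k -> k <> h.
Proof.
by case=> Hh Hk e n e'; move: e; rewrite e' setIid => h0; have [y] := half_neq0 Hh; rewrite h0.
Qed.

(** One representative of every wall, so that sums over walls become sums over half-spaces. *)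
Definition away : set (set Y) := [set h | H h /\ ~ h p].

Lemma away_or h : H h -> away h \/ away (~` h).
Proof.
by move=> Hh; case: (pselect (h p)) => hp; [right; split; first exact: halfC|left].
Qed.

Lemma awayC h : away h -> ~ away (~` h).
Proof. by move=> [_ np] [_]; apply => /np. Qed.

(** The fourth clause is admissibility with weights in place of a choice; the fifth is the
    counterpart of lying in the component of the base vertex. *)
Definition wpoint (x : set Y -> R) : Prop :=
  [/\ forall h, ~ H h -> x h = 0, forall h, H h -> 0 <= x h,
      forall h, H h -> x (~` h) = 1 - x h,
      forall h k, disjoint_halves h k -> x h = 0 \/ x k = 0 &
      finite_set [set h | away h /\ x h <> 0]].

(* Two points lie in a common cube. *)
Definition joint (x y : set Y -> R) : Prop :=
  [/\ wpoint x, wpoint y & forall h k, disjoint_halves h k ->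
     (x h = 0 /\ y h = 0) \/ (x k = 0 /\ y k = 0)].

Lemma wpoint_ge0 x h : wpoint x -> 0 <= x h.
Proof. by case=> e0 ge _ _ _; have [/ge|/e0 ->] := pselect (H h). Qed.

Lemma wpointC x h : wpoint x -> H h -> x (~` h) = 1 - x h.
Proof. by case=> _ _ + _ _; apply. Qed.

Lemma wpoint_le1 x h : wpoint x -> x h <= 1.
Proof.
move=> wx; have [Hh|nH] := pselect (H h); last by case: wx => e _ _ _ _; rewrite e.
by have := wpoint_ge0 (~` h) wx; rewrite (wpointC wx Hh); lra.
Qed.

Lemma wpoint_eq x y : wpoint x -> wpoint y -> (forall h, away h -> x h = y h) -> x = y.
Proof.
move=> wx wy e; apply/funext => h; have [Hh|nH] := pselect (H h); last first.
  by case: wx => -> // _ _ _ _; case: wy => ->.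
case: (away_or Hh) => [/e //|/e]; rewrite !wpointC //; lra.
Qed.

Lemma joint_refl x : wpoint x -> joint x x.
Proof. by move=> wx; split=> // h k /[dup] dj; case: wx => _ _ _ + _ => /[apply] -[]; [left|right]. Qed.

Lemma joint_sym x y : joint x y -> joint y x.
Proof. by case=> wx wy j; split=> // h k /j [[]|[]]; [left|right]. Qed.

(** The support is finite for two [wpoint]s, so this sum over a possibly infinite index set is a
    true sum. *)
Definition sqdist (x y : set Y -> R) : R := \sum_(h \in away) (x h - y h) ^+ 2.

Lemma sqdist_ge0 x y : 0 <= sqdist x y.
Proof. by apply: sumr_ge0 => h _; exact: sqr_ge0. Qed.

Lemma sqdist_sym x y : sqdist x y = sqdist y x.
Proof. by apply: eq_fsbigr => h _; rewrite -sqrrN opprB. Qed.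

Lemma sqdist_seq x y (r : list (set Y)) : uniq r -> (forall h, h \in r -> away h) ->
  (forall h, away h -> h \notin r -> x h = y h) ->
  sqdist x y = \sum_(h <- r) (x h - y h) ^+ 2.
Proof.
move=> ur sub off; rewrite fsbig_seq //; apply/esym/fsbig_widen; first by move=> h /=; exact: sub.
by move=> h [/= ah /negP nr]; rewrite (off h) // subrr expr0n.
Qed.

Lemma wpoint_support x y (F : set (set Y)) : wpoint x -> wpoint y -> finite_set F ->
  F `<=` away -> exists r : list (set Y), [/\ uniq r, forall h, h \in r -> away h,
    forall h, F h -> h \in r & forall h, away h -> h \notin r -> x h = 0 /\ y h = 0].
Proof.
move=> wx wy fF FA.
pose U := F `|` [set h | away h /\ x h <> 0] `|` [set h | away h /\ y h <> 0].
have fU : finite_set U by rewrite !finite_setU; case: wx => _ _ _ _ ?; case: wy => _ _ _ _ ?.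
exists (finmap.enum_fset (fset_set U)); split; first exact: finmap.fset_uniq.
- by move=> h; rewrite in_fset_set // inE => -[[/FA|[]]|[]].
- by move=> h Fh; rewrite in_fset_set // inE; left; left.
move=> h ah; rewrite in_fset_set // notin_setE => nU.
by split; apply: contrapT => n; apply: nU; [left; right|right].
Qed.

Lemma sqdist_le x y (x' y' : set Y -> R) : wpoint x -> wpoint y -> wpoint x' -> wpoint y' ->
  (forall h, away h -> (x' h - y' h) ^+ 2 <= (x h - y h) ^+ 2) ->
  sqdist x' y' <= sqdist x y.
Proof.
move=> wx wy wx' wy' le.
have [r [ur ra _ off]] := wpoint_support wx wy (finite_set0 _) (@sub0set _ _).
rewrite (@sqdist_seq x y r) // => [|h ah nr]; last by have [-> ->] := off h ah nr.
rewrite (@sqdist_seq x' y' r) // => [|h ah nr].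
  by rewrite big_seq [X in _ <= X]big_seq; apply: ler_sum => h /ra; exact: le.
have := le h ah; have [-> ->] := off h ah nr.
rewrite subrr expr0n /= => l0; apply/eqP; rewrite -subr_eq0 -sqrf_eq0 eq_le l0.
exact: sqr_ge0.
Qed.

Lemma sqdist_split x y (x' y' : set Y -> R) w : wpoint x -> wpoint y -> away w -> x' w = y' w ->
  (forall h, away h -> h <> w -> x' h - y' h = x h - y h) ->
  sqdist x y = (x w - y w) ^+ 2 + sqdist x' y'.
Proof.
move=> wx wy aw e off.
have [r [ur ra rw off']] := wpoint_support wx wy (finite_set1 w)
  (fun h e => eq_ind_r away aw e).
have wr : w \in r by exact: rw.
rewrite (@sqdist_seq x y r) // => [|h ah nr]; last by have [-> ->] := off' h ah nr.
rewrite (@sqdist_seq x' y' r) // => [|h ah nr].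
  rewrite (big_rem _ wr) /=; congr (_ + _); rewrite (big_rem _ wr) /= e subrr expr0n add0r.
  rewrite !big_seq; apply: eq_bigr => h; rewrite mem_rem_uniq // inE => /andP[/eqP hw /ra ah].
  by rewrite off.
have hw : h <> w by move=> hw; rewrite hw wr in nr.
by have [e1 e2] := off' h ah nr; apply/eqP; rewrite -subr_eq0 off // e1 e2 subrr.
Qed.

Lemma sqdist_coord x y h : wpoint x -> wpoint y -> H h -> (x h - y h) ^+ 2 <= sqdist x y.
Proof.
move=> wx wy Hh.
have key w : away w -> (x w - y w) ^+ 2 <= sqdist x y.
  move=> aw; rewrite (@sqdist_split x y (fun k => if k == w then 0 else x k)
     (fun k => if k == w then 0 else y k) w) ?eqxx // ?lerDl ?sqdist_ge0 //.
  by move=> k _ /eqP/negPf ->.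
case: (away_or Hh) => /key //; rewrite !wpointC // => le; apply: le_trans le.
by rewrite (_ : 1 - x h - (1 - y h) = - (x h - y h)) ?sqrrN //; ring.
Qed.

Lemma l2_le_sqdist x y (S : list (set Y)) : wpoint x -> wpoint y -> uniq S ->
  (forall h, h \in S -> away h) -> \sum_(h <- S) (x h - y h) ^+ 2 <= sqdist x y.
Proof.
move=> wx wy uS Sa.
have [r [ur ra _ off]] := wpoint_support wx wy (finite_set0 _) (@sub0set _ _).
pose S' := [seq h <- r | h \notin S].
rewrite (@sqdist_seq x y (S ++ S')).
- by rewrite big_cat lerDl; apply: sumr_ge0 => h _; exact: sqr_ge0.
- rewrite cat_uniq uS filter_uniq //= andbT; apply/hasPn => h.
  by rewrite mem_filter => /andP[].
- by move=> h; rewrite mem_cat mem_filter => /orP[/Sa|/andP[_ /ra]].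
- move=> h ah; rewrite mem_cat mem_filter negb_or => /andP[nS]; rewrite nS /= => nr.
  by have [-> ->] := off h ah nr.
Qed.

Definition edist (x y : set Y -> R) : R := Num.sqrt (sqdist x y).

Lemma edist_ge0 x y : 0 <= edist x y. Proof. exact: sqrtr_ge0. Qed.
Lemma edist_sym x y : edist x y = edist y x. Proof. by rewrite /edist sqdist_sym. Qed.

Lemma sqr_edist x y : edist x y ^+ 2 = sqdist x y.
Proof. by rewrite sqr_sqrtr // sqdist_ge0. Qed.

(** Chains without their cubes: asking only that consecutive points be [joint] makes induction,
    concatenation and retraction possible with no choice of corners. *)
Inductive route : (set Y -> R) -> (set Y -> R) -> R -> Prop :=
| route_nil x : wpoint x -> route x x 0
| route_cons x y z L : joint x y -> route y z L -> route x z (edist x y + L).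

Lemma route_ge0 x y L : route x y L -> 0 <= L.
Proof. by elim=> // {}x {}y z {}L _ _ L0; rewrite addr_ge0 ?edist_ge0. Qed.

Lemma route_cat x y z L M : route x y L -> route y z M -> route x z (L + M).
Proof.
move=> r; elim: r M => [{}x wx M|{}x {}y w {}L j r IH M r']; first by rewrite add0r.
by rewrite -addrA; apply: route_cons j _; exact: IH.
Qed.

Lemma joint_route x y : joint x y -> route x y (edist x y).
Proof. by move=> /[dup] j [_ wy _]; rewrite -[edist x y]addr0; apply: route_cons (route_nil wy). Qed.

Lemma route_sym x y L : route x y L -> exists M, route y x M.
Proof.
elim=> [{}x wx|{}x {}y w {}L j r [M IH]]; first by exists 0; exact: route_nil.
by exists (M + edist y x); apply: route_cat IH (joint_route (joint_sym j)).
Qed.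

Definition rdist (x y : set Y -> R) : R := inf [set L | route x y L].

Lemma rdist_le x y L : route x y L -> rdist x y <= L.
Proof. by move=> r; apply: ge_inf => //; exists 0 => M /route_ge0. Qed.

(* rdist is the largest subadditive function bounded by the Euclidean distance on cubes. *)
Lemma route_lower (F : (set Y -> R) -> (set Y -> R) -> R) :
  (forall x, wpoint x -> F x x <= 0) ->
  (forall x y z, wpoint x -> wpoint y -> wpoint z -> F x z <= F x y + F y z) ->
  (forall x y, joint x y -> F x y <= edist x y) ->
  forall x y L, route x y L -> F x y <= L.
Proof.
move=> F0 FD FE x y L; elim=> [{}x /F0 //|{}x {}y z {}L j r IH].
have wz : wpoint z by elim: r {IH}.
have [wx wy _] := j.
by apply: le_trans (FD x y z wx wy wz) _; rewrite lerD // FE.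
Qed.

End WallSpace.

Lemma exists_minimal_set {Y : Type} (P : set (set Y)) : finite_set P -> P !=set0 ->
  exists2 w, P w & forall k, P k -> k `<=` w -> k = w.
Proof.
move=> /finite_seqP[r Pr]; move eN : (size r) => n.
have {Pr} : forall h, P h -> h \in r by move=> h; rewrite Pr.
elim: n r eN P => [|n IH] r eN P Pr [h0 Ph0].
  by have := Pr _ Ph0; rewrite (size0nil eN).
have [|] := pselect (forall k, P k -> k `<=` h0 -> k = h0); first by exists h0.
move=> /existsNP[k /not_implyP[Pk /not_implyP[kh nkh]]].
have rh := Pr _ Ph0.
have [|||w [Pw wk] wmin] := IH (rem h0 r) _ [set l | P l /\ l `<=` k].
- by rewrite size_rem // eN.
- move=> l [Pl lk]; have [e|] := eqVneq l h0; first by case: nkh; apply/seteqP; split=> //; rewrite -e.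
  by have := perm_to_rem rh; move=> /perm_mem /(_ l); rewrite (Pr _ Pl) inE => /esym/orP[->|].
- by exists k; split.
by exists w => // l Pl lw; apply: wmin => //; split=> //; apply: subset_trans wk.
Qed.

(** * Compactness in finitely many coordinates *)

Section Compactness.
Context {R : realType}.

(** The limit superior, as the supremum of the levels that the sequence reaches arbitrarily late. *)
Lemma cluster_value (c : nat -> R) : (forall n, 0 <= c n <= 1) ->
  exists s, forall e, 0 < e -> forall N, exists2 n, (N <= n)%N & `|c n - s| < e.
Proof.
move=> c01.
pose A := [set r : R | forall N, exists2 n, (N <= n)%N & r <= c n].
have A0 : A 0 by move=> N; exists N => //; have /andP[] := c01 N.
have ubA : ubound A 1.
  by move=> r /(_ 0%N)[n _ rc]; apply: le_trans rc _; have /andP[] := c01 n.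
have hA : has_sup A by split; [exists 0|exists 1].
exists (sup A) => e e0 N.
have [r Ar rs] := sup_adherent e0 hA.
have nA : ~ A (sup A + e / 2).
  by move=> /(ub_le_sup (ex_intro _ 1 ubA)); lra.
have [N0 hN0] : exists N0, forall n, (N0 <= n)%N -> c n < sup A + e / 2.
  move: nA => /existsNP[N0 nN0]; exists N0 => n Nn.
  by rewrite ltNge; apply/negP => le; apply: nN0; exists n.
have [n Nn rc] := Ar (maxn N N0).
exists n; first by apply: leq_trans Nn; exact: leq_maxl.
have := hN0 n (leq_trans (leq_maxr _ _) Nn).
by move=> h; rewrite ltr_norml; apply/andP; split; lra.
Qed.

(** Decreasing sets replace subsequences: each coordinate in turn gets a cluster value, and the sets
    are cut down to the functions close to it before the next coordinate is treated. *)
Lemma pointwise_cluster {I : eqType} (F : list I) (S : nat -> set (I -> R)) :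
  (forall n, S n.+1 `<=` S n) -> (forall n, S n !=set0) ->
  (forall n c i, S n c -> 0 <= c i <= 1) ->
  exists x : I -> R, forall e, 0 < e -> forall n,
    exists2 c, S n c & forall i, i \in F -> `|c i - x i| < e.
Proof.
elim: F S => [|i F IH] S dec ne bd.
  by exists (fun=> 0) => e e0 n; have [c Sc] := ne n; exists c.
have decm m n : (m <= n)%N -> S n `<=` S m.
  by move=> /subnK <-; elim: (n - m)%N => // k IHk; apply: subset_trans IHk; exact: dec.
have /choice[c cS] := ne.
have [s hs] := cluster_value (fun n => bd n _ i (cS n)).
pose S' n := [set f | S n f /\ `|f i - s| < n.+1%:R^-1].
have [|n|n f k [Sf _]|x hx] := IH S'.
- move=> n f [Sf fi]; split; first exact: dec.
  by apply: lt_le_trans fi _; rewrite lef_pV2 ?posrE ?ltr0Sn // ler_nat.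
- have [|m nm cm] := hs n.+1%:R^-1 _ n; first by rewrite invr_gt0 ltr0Sn.
  by exists (c m); split=> //; exact: (decm _ _ nm).
- exact: bd Sf.
exists (fun k => if k == i then s else x k) => e e0 n.
pose m := maxn n (Num.truncn e^-1).
have me : m.+1%:R^-1 < e.
  rewrite invf_plt ?posrE ?ltr0Sn //.
  apply: lt_le_trans (truncnS_gt _) _; rewrite ler_nat ltnS; exact: leq_maxr.
have [f [Sf fi] ff] := hx e e0 m.
exists f; first by apply: (decm _ m) => //; exact: leq_maxl.
move=> k; rewrite inE; case: eqVneq => [-> _|_ /= kF]; first exact: lt_trans fi me.
exact: ff.
Qed.

Lemma pos_lower_bound {I : eqType} (F : list I) (x : I -> R) :
  exists2 e, 0 < e & forall i, i \in F -> 0 < x i -> e <= x i.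
Proof.
elim: F => [|i F [e e0 he]]; first by exists 1.
have [xi|xi] := ltP 0 (x i).
  exists (Num.min e (x i)); first by rewrite lt_min e0.
  move=> k; rewrite inE => /orP[/eqP -> _|kF xk]; first by rewrite ge_min lexx orbT.
  by rewrite ge_min he.
exists e => // k; rewrite inE => /orP[/eqP -> |kF]; last exact: he.
by rewrite ltNge xi.
Qed.

Lemma eq_of_small_dist (a b : R) : (forall e, 0 < e -> `|a - b| < e) -> a = b.
Proof.
move=> h; apply/eqP; rewrite -subr_eq0 -normr_eq0 eq_le normr_ge0 andbT leNgt.
by apply/negP => /h; rewrite ltxx.
Qed.

End Compactness.

(** * The path metric on weight functions *)

Section Complex.
Context {R : realType} {Y : Type}.
Variables (H : set (set Y)) (p : Y).
Hypothesis hW : space_with_walls H.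

Notation pt := (set Y -> R).
Notation wpoint := (@wpoint R Y H p).
Notation joint := (@joint R Y H p).
Notation away := (@away Y H p).
Notation disj := (@disjoint_halves Y H).
Notation sqdist := (@sqdist R Y H p).
Notation edist := (@edist R Y H p).
Notation route := (@route R Y H p).
Notation rdist := (@rdist R Y H p).
Implicit Types (x y z : pt) (h k w : set Y).

Definition upd x w (c : R) : pt :=
  fun h => if h == w then c else if h == ~` w then 1 - c else x h.

Lemma upd_at x w c : upd x w c w = c. Proof. by rewrite /upd eqxx. Qed.

Lemma updC_at x w c : upd x w c (~` w) = 1 - c.
Proof. by rewrite /upd eqxx; case: eqP => // /esym/(neq_setC p). Qed.

Lemma upd_off x w c h : h <> w -> h <> ~` w -> upd x w c h = x h.
Proof. by rewrite /upd => /eqP/negPf -> /eqP/negPf ->. Qed.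

Lemma upd_away x w c h : away w -> away h -> h <> w -> upd x w c h = x h.
Proof. by move=> aw ah hw; apply: upd_off => // e; apply: (awayC aw); rewrite -e. Qed.

Lemma upd_upd x w c c' : upd (upd x w c) w c' = upd x w c'.
Proof. by apply/funext => h; rewrite /upd; case: eqP => // _; case: eqP. Qed.

Lemma upd_id x w : wpoint x -> H w -> upd x w (x w) = x.
Proof.
move=> wx Hw; apply/funext => h; rewrite /upd; case: eqP => [-> //|_].
by case: eqP => [->|//]; rewrite (wpointC wx).
Qed.

(** Changing the weight of a wall can only conflict with half-spaces disjoint from one of its two
    sides; the last two hypotheses rule out exactly these conflicts. *)
Lemma joint_upd x y w (c c' : R) : joint x y -> H w -> 0 <= c <= 1 -> 0 <= c' <= 1 ->
  (forall k, disj w k -> (c = 0 /\ c' = 0) \/ (x k = 0 /\ y k = 0)) ->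
  (forall k, disj (~` w) k -> (c = 1 /\ c' = 1) \/ (x k = 0 /\ y k = 0)) ->
  joint (upd x w c) (upd y w c').
Proof.
move=> [wx wy j] Hw c01 c01' hw hw'.
have HCw := halfC hW Hw.
have J h k : disj h k -> (upd x w c h = 0 /\ upd y w c' h = 0) \/
                         (upd x w c k = 0 /\ upd y w c' k = 0).
  move=> dj; have [Hh Hk e n] := dj.
  have kh := disjoint_halves_neq hW dj.
  have [hE|hw1] := pselect (h = w).
    rewrite hE !upd_at !upd_off; try by rewrite -?hE.
    by apply: hw; rewrite -hE.
  have [hE|hw2] := pselect (h = ~` w).
    rewrite hE !updC_at !upd_off; try by rewrite -?hE // -(setCK w) -hE.
    by have := hw' k; rewrite -hE => /(_ dj) [[-> ->]|?]; [left; rewrite subrr|right].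
  rewrite !(upd_off _ _ hw1 hw2).
  have dj' := disjoint_halves_sym dj.
  have [kE|kw1] := pselect (k = w).
    rewrite kE !upd_at; rewrite kE in dj'.
    by case: (hw _ dj') => ?; [right|left].
  have [kE|kw2] := pselect (k = ~` w).
    rewrite kE !updC_at; rewrite kE in dj'.
    by case: (hw' _ dj') => [[-> ->]|?]; [right; rewrite subrr|left].
  by rewrite !(upd_off _ _ kw1 kw2); exact: j.
have W z (d : R) : wpoint z -> 0 <= d <= 1 -> (forall h k, disj h k -> upd z w d h = 0 \/ upd z w d k = 0) ->
    wpoint (upd z w d).
  move=> wz /andP[d0 d1] dz; split=> //.
  - move=> h nH; rewrite upd_off; [by case: wz => -> | by move=> e; apply: nH; rewrite e ..].
  - move=> h _; rewrite /upd; case: eqP => // _; case: eqP => [_|_]; first by rewrite subr_ge0.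
    exact: wpoint_ge0 wz.
  - move=> h Hh; rewrite /upd.
    case: (eqVneq h w) => [->|hw1].
      by rewrite eqxx; case: eqP => // /esym/(neq_setC p).
    case: (eqVneq h (~` w)) => [->|hw2]; first by rewrite setCK eqxx; lra.
    case: eqP => [e|_]; first by case/eqP: hw2; rewrite -e setCK.
    case: eqP => [e|_]; first by case/eqP: hw1; rewrite -(setCK h) e setCK.
    exact: wpointC wz Hh.
  - apply: (@sub_finite_set _ _ ([set h | away h /\ z h <> 0] `|` [set w; ~` w])).
      move=> h [ah]; rewrite /upd; case: eqP => [-> _|_]; first by right; left.
      by case: eqP => [-> _|_ ?]; [right; right|left].
    by rewrite finite_setU; split=> //; case: wz.
split=> //; first by apply: W => // h k /J [[]|[]]; [left|right].
by apply: W => // h k /J [[]|[]]; [left|right].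
Qed.

Lemma wpoint_upd x w (c : R) : wpoint x -> H w -> 0 <= c <= 1 ->
  (forall k, disj w k -> c = 0 \/ x k = 0) ->
  (forall k, disj (~` w) k -> c = 1 \/ x k = 0) -> wpoint (upd x w c).
Proof.
move=> wx Hw c01 h1 h2; suff [] : joint (upd x w c) (upd x w c) by [].
apply: joint_upd => //; first exact: joint_refl.
- by move=> k /h1[]; [left|right].
- by move=> k /h2[]; [left|right].
Qed.

(** The target is the vertex of [p]. An inclusion-minimal half-space of non-zero weight not
    containing [p] can be emptied within one cube, and the number of such half-spaces drops. *)
Lemma routes_from x : wpoint x ->
  exists L, route x (fun h => if `[<H h /\ h p>] then 1 else 0) L.
Proof.
move=> wx; have [_ _ _ _ /finite_seqP[r]] := wx.
move eN : (size r) => n.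
move=> Pr; have {Pr} : forall h, away h -> x h <> 0 -> h \in r.
  move=> h ah xh; have : [set` r] h by rewrite -Pr.
  by [].
elim: n r eN x wx => [|n IH] r eN x wx Pr.
  suff <- : x = (fun h => if `[<H h /\ h p>] then 1 else 0) by exists 0; exact: route_nil.
  have x0 h : away h -> x h = 0.
    by move=> ah; apply: contrapT => /(Pr _ ah); rewrite (size0nil eN).
  apply/funext => h; case: asboolP => [[Hh hp]|nhp].
    have : away (~` h) by split; [exact: halfC|move=> nh; exact: nh].
    by move=> /x0; rewrite (wpointC wx Hh); lra.
  have [Hh|nH] := pselect (H h); last by case: wx => ->.
  by apply: x0; split=> // hp; exact: nhp.
have [ne|e] := pselect ([set h | away h /\ x h <> 0] !=set0); last first.
  have [//||L rL] := IH (behead r) _ x wx; first by rewrite size_behead eN.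
    by move=> h ah xh; case: e; exists h.
  by exists L.
have [_ _ _ _ fx] := wx.
have [w [aw xw] wmin] := exists_minimal_set fx ne.
have Hw : H w by case: aw.
have x01 : 0 <= x w <= 1 by rewrite (wpoint_ge0 _ wx) (wpoint_le1 _ wx).
(* Such a [k] lies strictly inside [w], so it also misses [p] and minimality of [w] makes its weight
   zero. *)
have sub k : disj (~` w) k -> x k = 0.
  move=> [_ Hk e nkw]; apply: contrapT => xk.
  have kw : k `<=` w.
    move=> y ky; apply: contrapT => nw; have : (~` w `&` k) y by [].
    by rewrite e.
  apply: nkw; rewrite setCK; apply: wmin => //; split=> //; split=> // kp.
  by case: aw => _; apply; exact: kw.
have j : joint (upd x w (x w)) (upd x w 0).
  apply: joint_upd => //; first exact: joint_refl.
  - by rewrite lexx ler01.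
  - move=> k dj; right; case: wx => _ _ _ /(_ _ _ dj) [|//].
    by move=> xw0; case: xw.
  - by move=> k /sub; right.
rewrite upd_id // in j.
have [_ wu _] := j.
have wr : w \in r by exact: Pr.
have [//||L rL] := IH (rem w r) _ _ wu; first by rewrite size_rem // eN.
  move=> h ah; have [->|hw] := pselect (h = w); first by rewrite upd_at.
  rewrite upd_away // => xh.
  have := perm_mem (perm_to_rem wr) h; rewrite (Pr _ ah xh) inE => /esym/orP[/eqP //|//].
by exists (edist x (upd x w 0) + L); exact: route_cons rL.
Qed.

Lemma route_exists x y : wpoint x -> wpoint y -> exists L, route x y L.
Proof.
move=> /routes_from[L rL] /routes_from[M rM]; have [N rN] := route_sym rM.
by exists (L + N); exact: route_cat rL rN.
Qed.

Lemma le_rdist x y (c : R) : wpoint x -> wpoint y -> (forall L, route x y L -> c <= L) -> c <= rdist x y.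
Proof.
move=> wx wy h; apply: lb_le_inf; first exact: route_exists.
by move=> L; exact: h.
Qed.

Lemma rdist_approx x y (e : R) : wpoint x -> wpoint y -> 0 < e ->
  exists2 L, route x y L & L < rdist x y + e.
Proof.
move=> wx wy e0; apply: inf_adherent => //; split; first exact: route_exists.
by exists 0 => L; exact: route_ge0.
Qed.

Lemma rdist_lower (F : pt -> pt -> R) :
  (forall x, wpoint x -> F x x <= 0) ->
  (forall x y z, wpoint x -> wpoint y -> wpoint z -> F x z <= F x y + F y z) ->
  (forall x y, joint x y -> F x y <= edist x y) ->
  forall x y, wpoint x -> wpoint y -> F x y <= rdist x y.
Proof. by move=> F0 FD FE x y wx wy; apply: le_rdist => // L; exact: route_lower. Qed.

Lemma rdist_joint x y : joint x y -> rdist x y <= edist x y.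
Proof. by move=> j; apply: rdist_le; exact: joint_route. Qed.

Lemma rdist_ge0 x y : wpoint x -> wpoint y -> 0 <= rdist x y.
Proof. by move=> wx wy; apply: le_rdist => // L; exact: route_ge0. Qed.

Lemma rdist_refl x : wpoint x -> rdist x x = 0.
Proof.
move=> wx; apply/eqP; rewrite eq_le rdist_ge0 // andbT; apply: rdist_le.
exact: route_nil.
Qed.

Lemma rdist_tri x y z : wpoint x -> wpoint y -> wpoint z ->
  rdist x z <= rdist x y + rdist y z.
Proof.
move=> wx wy wz; rewrite -lerBlDl; apply: le_rdist => // M rM.
rewrite lerBlDl -lerBlDr; apply: le_rdist => // L rL.
by rewrite lerBlDr; apply: rdist_le; exact: route_cat rL rM.
Qed.

Lemma rdist_sym x y : wpoint x -> wpoint y -> rdist x y = rdist y x.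
Proof.
move=> wx wy.
have key u v : wpoint u -> wpoint v -> rdist v u <= rdist u v.
  apply: (@rdist_lower (fun u v => rdist v u)).
  - by move=> {}x {}wx; rewrite rdist_refl.
  - by move=> a b c wa wb wc; rewrite addrC; exact: rdist_tri.
  - by move=> a b j; rewrite edist_sym; apply: rdist_joint; exact: joint_sym.
by apply/eqP; rewrite eq_le !key.
Qed.

(** Each coordinate is 1-Lipschitz; this is what keeps the infimum over routes from vanishing on
    distinct points. *)
Lemma coord_le_rdist x y h : wpoint x -> wpoint y -> H h -> `|x h - y h| <= rdist x y.
Proof.
move=> wx wy Hh; move: x y wx wy; apply: (@rdist_lower (fun x y => `|x h - y h|)).
- by move=> x _; rewrite subrr normr0.
- by move=> x y z _ _ _; apply: le_trans (ler_normD _ _); rewrite addrA subrK.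
- by move=> x y [wx wy _]; rewrite -sqrtr_sqr ler_wsqrtr // sqdist_coord.
Qed.

Lemma rdist_metric : is_metric_on wpoint rdist.
Proof.
move=> x y z wx wy wz; split; [split|exact: rdist_sym|exact: rdist_tri].
- move=> e; apply: (wpoint_eq hW wx wy) => h [Hh _].
  have := coord_le_rdist wx wy Hh; rewrite e normr_le0 subr_eq0 => /eqP //.
- by move=> <-; exact: rdist_refl.
Qed.

Lemma l2_le_rdist x y (S : list (set Y)) : wpoint x -> wpoint y -> uniq S ->
  (forall h, h \in S -> away h) ->
  Num.sqrt (\sum_(h <- S) (x h - y h) ^+ 2) <= rdist x y.
Proof.
move=> wx wy uS Sa; move: x y wx wy.
apply: (@rdist_lower (fun x y => Num.sqrt (\sum_(h <- S) (x h - y h) ^+ 2))).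
- move=> x _; rewrite big1 ?sqrtr0 // => h _; by rewrite subrr expr0n.
- by move=> x y z _ _ _; exact: l2_triangle.
- by move=> x y [wx wy _]; rewrite ler_wsqrtr // l2_le_sqdist.
Qed.

(** * Gates *)

Section Gate.
Variable Z : set pt.
Hypothesis Zw : Z `<=` wpoint.
Hypothesis Z0 : Z !=set0.

Definition vanishes h : Prop := forall z, Z z -> z h = 0.

Lemma vanishesC h : H h -> vanishes h -> ~ vanishes (~` h).
Proof.
move=> Hh n n'; have [z Zz] := Z0; have := n' z Zz.
by rewrite (wpointC (Zw Zz) Hh) (n z Zz) subr0 => /eqP; rewrite oner_eq0.
Qed.

(** The gate projection of median geometry: walls that have all of [Z] on one side are set to that
    side, the other coordinates are kept. *)
Definition gate x : pt :=
  fun h => if `[<vanishes h>] then 0 else if `[<vanishes (~` h)>] then 1 else x h.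

(** If [Z] lies entirely on the side [h], every half-space disjoint from [h] vanishes on [Z] and is
    reset to 0 too. So a coordinate raised to 1 never meets a conflicting one, and kept coordinates
    inherit compatibility. *)
Lemma gate_joint x y : joint x y -> joint (gate x) (gate y).
Proof.
move=> [wx wy j].
have J h k : disj h k -> (gate x h = 0 /\ gate y h = 0) \/ (gate x k = 0 /\ gate y k = 0).
  have key h' k' : disj h' k' -> vanishes (~` h') -> vanishes k'.
    move=> dj n z Zz; have wz := Zw Zz; have [Hh _ _ _] := dj.
    have := n z Zz; rewrite (wpointC wz Hh) => zh.
    by case: wz => _ _ _ /(_ _ _ dj) [e|//] _; move: zh; rewrite e subr0 => /eqP; rewrite oner_eq0.
  move=> dj; rewrite /gate.
  have [|nh] := asboolP (vanishes h); first by left.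
  have [|nk] := asboolP (vanishes k); first by right.
  have [/(key _ _ dj) //|nh'] := asboolP (vanishes (~` h)).
  have [/(key _ _ (disjoint_halves_sym dj)) //|nk'] := asboolP (vanishes (~` k)).
  exact: j.
have W z : wpoint z -> (forall h k, disj h k -> gate z h = 0 \/ gate z k = 0) -> wpoint (gate z).
  move=> wz dz; split=> //.
  - move=> h nH; rewrite /gate asboolT // => u /Zw; by case => ->.
  - by move=> h Hh; rewrite /gate; case: asboolP => // _; case: asboolP => // _; exact: wpoint_ge0 wz.
  - move=> h Hh; rewrite /gate setCK.
    case: (asboolP (vanishes h)) => [n|n].
      by rewrite asboolF ?subr0 //; exact: vanishesC.
    by case: asboolP => [_|_]; [rewrite subrr|exact: wpointC wz Hh].
  - have [u Zu] := Z0.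
    apply: (@sub_finite_set _ _ ([set h | away h /\ z h <> 0] `|` [set h | away h /\ u h <> 0])).
      move=> h [ah]; rewrite /gate; case: asboolP => // _; case: asboolP => [n _|_ ?]; last by left.
      right; split=> // uh; have [Hh _] := ah; have := n u Zu.
      by rewrite (wpointC (Zw Zu) Hh) uh subr0 => /eqP; rewrite oner_eq0.
    by rewrite finite_setU; case: wz => _ _ _ _ ?; case: (Zw Zu).
split=> //; first by apply: W => // h k /J [[]|[]]; [left|right].
by apply: W => // h k /J [[]|[]]; [left|right].
Qed.

Lemma wpoint_gate x : wpoint x -> wpoint (gate x).
Proof. by move=> /(joint_refl (p := p)) /gate_joint[]. Qed.

Lemma gate_id x : wpoint x -> (forall h, H h -> vanishes h -> x h = 0) -> gate x = x.
Proof.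
move=> wx n; apply/funext => h; rewrite /gate.
have [Hh|nH] := pselect (H h); last first.
  by rewrite asboolT => [|z /Zw [->//]]; case: wx => ->.
case: asboolP => [/(n _ Hh) //|_]; case: asboolP => [/(n _ (halfC hW Hh))|//].
by rewrite (wpointC wx Hh); lra.
Qed.

Lemma gate_sqdist x y : wpoint x -> wpoint y -> sqdist (gate x) (gate y) <= sqdist x y.
Proof.
move=> wx wy; apply: sqdist_le => //; try exact: wpoint_gate.
move=> h _; rewrite /gate; case: asboolP => _; first by rewrite subrr expr0n sqr_ge0.
by case: asboolP => _ //; rewrite subrr expr0n sqr_ge0.
Qed.

Lemma gate_rdist x y : wpoint x -> wpoint y -> rdist (gate x) (gate y) <= rdist x y.
Proof.
apply: (@rdist_lower (fun x y => rdist (gate x) (gate y))).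
- by move=> u wu; rewrite rdist_refl //; exact: wpoint_gate.
- by move=> u v w wu wv ww; apply: rdist_tri; exact: wpoint_gate.
- move=> u v j; apply: le_trans (rdist_joint (gate_joint j)) _.
  by case: j => wu wv _; rewrite ler_wsqrtr // gate_sqdist.
Qed.

End Gate.

End Complex.

(** * Convex subcomplexes *)

Section Faces.
Context {R : realType} {Y : Type}.
Variables (H : set (set Y)) (p : Y).
Hypothesis hW : space_with_walls H.

Notation pt := (set Y -> R).
Notation wpoint := (@wpoint R Y H p).
Notation joint := (@joint R Y H p).
Notation away := (@away Y H p).
Notation disj := (@disjoint_halves Y H).
Notation sqdist := (@sqdist R Y H p).
Notation edist := (@edist R Y H p).
Notation route := (@route R Y H p).
Notation rdist := (@rdist R Y H p).
Implicit Types (x y z : pt) (h k w : set Y) (L : set (set Y)).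

(** A convex subcomplex given by the half-spaces it avoids; enlarging [L] shrinks it. *)
Definition face L : set pt := [set x | wpoint x /\ forall h, L h -> x h = 0].

Definition separates L h : Prop :=
  [/\ H h, exists2 z, face L z & z h <> 0 & exists2 z, face L z & z h <> 1].

(** Half-spaces lying inside one side of [w] and belonging to another wall. Making them vanish
    leaves the carrier of the wall of [w], the union of the cubes that it crosses. *)
Definition nested w : set (set Y) := [set k | disj w k \/ disj (~` w) k].

Lemma face_wpoint L : face L `<=` wpoint. Proof. by move=> x []. Qed.
Hint Resolve face_wpoint : core.

Lemma face_subset L L' : L `<=` L' -> face L' `<=` face L.
Proof. by move=> sub x [wx x0]; split=> // h /sub; exact: x0. Qed.

Lemma separates_subset L L' h : L `<=` L' -> separates L' h -> separates L h.
Proof.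
move=> /face_subset sub [Hh [z /sub fz z0] [z' /sub fz' z1]].
by split=> //; [exists z|exists z'].
Qed.

Lemma separatesC L h : separates L h -> separates L (~` h).
Proof.
move=> [Hh [z fz z0] [z' fz' z1]]; split; first exact: halfC.
- by exists z' => //; rewrite (wpointC (face_wpoint fz') Hh) => e; apply: z1; lra.
- by exists z => //; rewrite (wpointC (face_wpoint fz) Hh) => e; apply: z0; lra.
Qed.

Lemma separates_notin L w : separates L w -> ~ L w /\ ~ L (~` w).
Proof.
move=> sw; have [Hw [z [_ z0] zw] _] := sw; split=> [/z0 //|].
by have [_ [z' [_ z0'] zw'] _] := separatesC sw => /z0'.
Qed.

Lemma nestedC w : nested (~` w) = nested w.
Proof. by apply/seteqP; rewrite /nested setCK; split=> k [] ?; [right|left|right|left]. Qed.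

Lemma nested_off w k : nested w k -> k <> w /\ k <> ~` w.
Proof.
case=> dj; have n := disjoint_halves_neq hW dj; have [_ _ _] := dj; last by rewrite setCK.
by [].
Qed.

Lemma gate_face L x : face L !=set0 -> wpoint x -> face L (gate (face L) x).
Proof.
move=> ne wx; split; first exact: (wpoint_gate (face_wpoint (L:=L)) ne wx).
by move=> h Lh; rewrite /gate asboolT // => z [_ ->].
Qed.

Lemma face_gate L x : face L x -> gate (face L) x = x.
Proof. by move=> fx; apply: (gate_id hW (face_wpoint (L:=L))) => // [|h _]; [exact: face_wpoint fx|exact]. Qed.

(** The point is the last one before the first step that leaves [w = 0]. In the cube of that step
    the weight of [w] varies, so no half-space nested with [w] can have weight there. *)
Lemma route_crossing w x y M : route x y M -> H w -> x w = 0 -> y w <> 0 ->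
  exists z M1 M2, [/\ route x z M1, route z y M2, M1 + M2 = M, z w = 0 &
    forall k, nested w k -> z k = 0].
Proof.
move=> r Hw; elim: r => [u wu -> //|u v t L j r IH u0 t0].
have [v0|v0] := eqVneq (v w) 0.
  have [z [M1 [M2 [r1 r2 e z0 zk]]]] := IH v0 t0.
  by exists z, (edist u v + M1), M2; split=> //; [exact: route_cons r1|rewrite -e addrA].
have [wu wv jj] := j.
exists u, 0, (edist u v + L); split=> //; rewrite ?add0r //.
- exact: route_nil.
- exact: route_cons r.
move=> k [] /jj [] [] //; first by move=> _ /eqP; rewrite (negPf v0).
by rewrite (wpointC wu Hw) u0 subr0 => /eqP; rewrite oner_eq0.
Qed.

Lemma route_wpoint x y M : route x y M -> wpoint x /\ wpoint y.
Proof. by elim=> // u v t L [wu _ _] _ [_ wt]. Qed.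

(** The route may leave the face, so its crossing point is pulled back by the gate, which fixes [x]
    and [y] and does not increase distances. As [w] separates the face, the gate raises neither [w]
    nor a nested half-space to 1. *)
Lemma face_crossing L w x y M : separates L w -> face L x -> face L y -> route x y M ->
  x w = 0 -> y w <> 0 ->
  exists2 c, face (L `|` nested w `|` [set w]) c & rdist x c + rdist c y <= M.
Proof.
move=> sw fx fy r x0 y0; have [Hw [u fu u0] [v fv v1]] := sw.
have [z [M1 [M2 [r1 r2 <- z0 zk]]]] := route_crossing r Hw x0 y0.
have ne : face L !=set0 by exists x.
have [[wx wz] [_ wy]] := (route_wpoint r1, route_wpoint r2).
exists (gate (face L) z).
  have [wg gL] := gate_face ne wz; split=> // h [[/gL //|nh]|->].
    have vC : ~ vanishes (face L) (~` h).
      move=> va; case: nh => dj; have [Hw' Hh _ _] := dj.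
        apply: u0; have := va u fu; rewrite (wpointC (face_wpoint fu) Hh) => uh.
        by have [_ _ _ /(_ _ _ dj) [//|]] := face_wpoint fu; lra.
      apply: v1; have := va v fv; rewrite (wpointC (face_wpoint fv) Hh) => vh.
      have [_ _ _ /(_ _ _ dj) [|]] := face_wpoint fv; last by lra.
      by rewrite (wpointC (face_wpoint fv) Hw); lra.
    by rewrite /gate; case: asboolP => // _; rewrite asboolF // zk.
  rewrite /gate; case: asboolP => // _; rewrite asboolF //.
  move=> va; apply: v1; have := va v fv; rewrite (wpointC (face_wpoint fv) Hw); lra.
rewrite -{1}(face_gate fx) -{1}(face_gate fy).
have h1 := gate_rdist hW (face_wpoint (L:=L)) ne wx wz.
have h2 := gate_rdist hW (face_wpoint (L:=L)) ne wz wy.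
have := rdist_le r1; have := rdist_le r2; lra.
Qed.

(* Near its limit X, a sequence of points of the face shares a cube with X. *)
Lemma face_minimizer L (s : list (set Y)) a b : face L !=set0 ->
  (forall h, separates L h -> away h -> h \in s) -> wpoint a -> wpoint b ->
  exists2 c, face L c & forall c', face L c' ->
    rdist a c + rdist c b <= rdist a c' + rdist c' b.
Proof.
move=> [z0 fz0] sP wa wb.
pose phi c := rdist a c + rdist c b.
have phi0 c : face L c -> 0 <= phi c.
  by move=> fc; rewrite addr_ge0 // rdist_ge0 //; exact: face_wpoint fc.
pose m := inf (phi @` face L).
have lbm : has_inf (phi @` face L).
  by split; [exists (phi z0); exists z0|exists 0 => _ [c fc <-]; exact: phi0].
have m_le c : face L c -> m <= phi c.
  by move=> fc; apply: ge_inf; [exact: lbm.2|exists c].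
(* Decreasing sets of near-minimisers, to which the cluster lemma applies. *)
pose S n := [set c | face L c /\ phi c < m + n.+1%:R^-1].
pose t := [seq h <- undup s | `[<away h>]].
have ut : uniq t by rewrite filter_uniq // undup_uniq.
have ta h : h \in t -> away h by rewrite mem_filter => /andP[/asboolP].
have tP h : separates L h -> away h -> h \in t.
  by move=> sh ah; rewrite mem_filter mem_undup sP // andbT; apply/asboolP.
have [|n|n c i [fc _]|x0 hx0] := @pointwise_cluster R (set Y) t S.
- move=> n c [fc lt]; split=> //; apply: lt_le_trans lt _.
  by rewrite lerD2l lef_pV2 ?posrE ?ltr0Sn // ler_nat.
- have [|_ [c fc <-] lt] := @inf_adherent _ _ n.+1%:R^-1 _ lbm; first by rewrite invr_gt0 ltr0Sn.
  by exists c.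
- by rewrite (wpoint_ge0 _ (face_wpoint fc)) (wpoint_le1 _ (face_wpoint fc)).
(* Coordinates that do not separate the face are constant on it and are copied from [z0]; the others
   come from the cluster point of their representative missing [p]. *)
pose x h := if `[<separates L h>] then (if `[<away h>] then x0 h else 1 - x0 (~` h)) else z0 h.
have off c h : face L c -> ~ separates L h -> c h = z0 h.
  move=> fc ns; have [Hh|nH] := pselect (H h); last first.
    by case: (face_wpoint fc) => -> //; case: (face_wpoint fz0) => ->.
  have [e|n0] := pselect (forall z, face L z -> z h = 0); first by rewrite !e.
  have [e|n1] := pselect (forall z, face L z -> z h = 1); first by rewrite !e.
  case: ns; split=> //.
    by move/existsNP: n0 => [z /not_implyP[? ?]]; exists z.
  by move/existsNP: n1 => [z /not_implyP[? ?]]; exists z.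
have close c e : 0 < e -> face L c -> (forall i, i \in t -> `|c i - x0 i| < e) ->
    forall h, `|c h - x h| < e.
  move=> e0 fc ct h; rewrite /x; case: asboolP => [sh|ns]; last by rewrite (off c h) // subrr normr0.
  case: asboolP => [ah|na]; first by apply: ct; exact: tP.
  have [Hh _ _] := sh.
  have ac : away (~` h) by case: (away_or p hW Hh).
  have := ct _ (tP _ (separatesC sh) ac).
  rewrite (wpointC (face_wpoint fc) Hh) -normrN.
  by congr (`|_| < _); ring.
have lim e n : 0 < e -> exists2 c, S n c & forall h, `|c h - x h| < e.
  by move=> e0; have [c Sc ct] := hx0 e e0 n; exists c => //; apply: close => //; case: Sc.
have wx : wpoint x.
  split.
  - move=> h nH; rewrite /x asboolF; last by case.
    by case: (face_wpoint fz0) => ->.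
  - move=> h Hh; rewrite leNgt; apply/negP => lt.
    have [c [fc _] /(_ h)] := lim (- x h) 0%N ltac:(by rewrite oppr_gt0).
    by have := wpoint_ge0 h (face_wpoint fc); move=> c0; rewrite ger0_norm; lra.
  - move=> h Hh; apply: eq_of_small_dist => e e0.
    have [c [fc _] cx] := lim (e / 2) 0%N ltac:(by rewrite divr_gt0).
    have := cx h; have := cx (~` h); rewrite (wpointC (face_wpoint fc) Hh).
    by rewrite !ltr_norml => /andP[? ?] /andP[? ?]; apply/andP; split; lra.
  - move=> h k dj; apply: contrapT => /not_orP[/eqP xh /eqP xk].
    have mp : 0 < Num.min `|x h| `|x k| by rewrite lt_min !normr_gt0 xh xk.
    have [c [fc _] cx] := lim _ 0%N mp.
    have := cx h; have := cx k; rewrite !lt_min.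
    have [_ _ _ /(_ _ _ dj) [->|->] _] := face_wpoint fc.
      by move=> _ /andP[]; rewrite add0r normrN ltxx.
    by move=> /andP[_]; rewrite add0r normrN ltxx.
  - apply: (@sub_finite_set _ _ ([set` t] `|` [set h | away h /\ z0 h <> 0])).
      move=> h [ah]; rewrite /x; case: asboolP => [sh _|_ ?]; last by right.
      by left; exact: tP.
    by rewrite finite_setU; split=> //; case: (face_wpoint fz0).
have fx : face L x.
  split=> // h Lh; apply/esym; apply: eq_of_small_dist => e e0.
  by have [c [[_ c0] _] /(_ h)] := lim e 0%N e0; rewrite c0.
exists x => // c' fc'; rewrite -/(phi x) -/(phi c').
apply: le_trans (m_le _ fc').
(* Closer than [e1] to [x], a point of the face is non-zero wherever [x] is; then it shares a cube
   with [x] and coordinatewise closeness bounds the distance. *)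
have [e1 e10 e1P] := pos_lower_bound (t ++ [seq ~` h | h <- t]) x.
have nx h : x h <> 0 -> separates L h -> e1 <= x h.
  move=> xh sh; apply: e1P; last by rewrite lt_neqAle (wpoint_ge0 _ wx) andbT eq_sym; apply/eqP.
  have [Hh _ _] := sh; rewrite mem_cat; case: (away_or p hW Hh) => ah; first by rewrite tP.
  by apply/orP; right; apply/mapP; exists (~` h); rewrite ?setCK // tP //; exact: separatesC.
have near c e : 0 < e -> e <= e1 -> face L c -> (forall h, `|c h - x h| < e) ->
    rdist c x <= (size t).+1%:R * e.
  move=> e0 le fc cx; have wc := face_wpoint fc.
  have cn0 h : x h <> 0 -> c h <> 0.
    move=> xh; have [sh|ns] := pselect (separates L h).
      move=> ch; have := cx h; rewrite ch add0r normrN ger0_norm ?(wpoint_ge0 _ wx) //.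
      by have := nx h xh sh; lra.
    by rewrite (off c h) //; move: xh; rewrite /x asboolF.
  have j : joint c x.
    split=> // h k dj.
    have [_ _ _ /(_ _ _ dj) dc _] := wc; have [_ _ _ /(_ _ _ dj) dx _] := wx.
    have [xh|xh] := pselect (x h = 0); last first.
      by right; split; [case: dc => // /(cn0 _ xh)|case: dx].
    have [xk|xk] := pselect (x k = 0); last by left; split=> //; case: dc => // /(cn0 _ xk).
    by case: dc; [left|right].
  apply: le_trans (rdist_joint j) _; apply: sqrt_le_of_sqr; first by rewrite mulr_ge0 // ltW.
  rewrite (@sqdist_seq R Y H p c x t) // => [|h ah nt]; last first.
    have ns : ~ separates L h by move=> sh; rewrite tP in nt.
    by rewrite (off c h) // /x asboolF.
  have : \sum_(h <- t) (c h - x h) ^+ 2 <= \sum_(h <- t) e ^+ 2.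
    by apply: ler_sum => h _; rewrite -(real_normK (num_real (c h - x h))) ler_sqr ?nnegrE ?normr_ge0 ?(ltW e0) // ltW.
  move=> le1; apply: le_trans le1 _.
  rewrite big_const_seq count_predT iter_addr_0 exprMn -[e ^+ 2 *+ _]mulr_natl.
  rewrite ler_wpM2r ?sqr_ge0 // -natrX ler_nat.
  by apply: leq_trans (leqnSn _) _; rewrite -[X in (X <= _)%N]expn1 leq_pexp2l.
apply/ler_addgt0Pr => e e0.
(* The successor keeps the constant positive when [t] is empty. The tolerance [e / 4] is spent twice
   on the distance from [x] to [c] and once on near-minimality of [c]. *)
pose N := (size t).+1%:R : R.
have N0 : 0 < N by rewrite ltr0Sn.
have [e2 [e20 e21 e2e]] : exists e2, [/\ 0 < e2, e2 <= e1 & N * e2 <= e / 4].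
  exists (Num.min e1 (e / 4 / N)); split.
  - by rewrite lt_min e10 !divr_gt0.
  - by rewrite ge_min lexx.
  - by rewrite mulrC -ler_pdivlMr // ge_min lexx orbT.
have [n ne] : exists n, n.+1%:R^-1 < e / 4.
  exists (Num.truncn (e / 4)^-1); rewrite invf_plt ?posrE ?ltr0Sn ?divr_gt0 //.
  exact: truncnS_gt.
have [c [fc lt] cx] := lim e2 n e20.
have := near c e2 e20 e21 fc cx; rewrite -/N => nr.
have wc := face_wpoint fc.
have t1 := rdist_tri hW wa wc wx; have t2 := rdist_tri hW wx wc wb.
have sy := rdist_sym hW wx wc; have px : phi x = rdist a x + rdist x b by [].
have pc : phi c = rdist a c + rdist c b by [].
move: (phi x) (phi c) m (n.+1%:R^-1) px pc lt ne {lbm m_le S hx0 lim} => A B M' k px pc lt ne; lra.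
Qed.

(** Every route crosses the cut at a point whose detour is no longer than the route. A minimiser of
    the detour over the cut therefore attains the distance. *)
Lemma face_through L w (s : list (set Y)) x y :
  (forall h, separates L h -> away h -> h \in s) -> separates L w ->
  face L x -> face L y -> x w = 0 -> y w <> 0 ->
  exists2 c, face (L `|` nested w `|` [set w]) c & rdist x y = rdist x c + rdist c y.
Proof.
move=> sP sw fx fy x0 y0; have wx := face_wpoint fx; have wy := face_wpoint fy.
set K := _ `|` _.
have LK : L `<=` K by move=> h; left; left.
have neK : face K !=set0.
  have [M r] := route_exists hW wx wy.
  by have [c fc _] := face_crossing sw fx fy r x0 y0; exists c.
have sK h : separates K h -> away h -> h \in s by move=> /(separates_subset LK); exact: sP.
have [c fc cmin] := face_minimizer neK sK wx wy.
have wc := face_wpoint fc.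
exists c => //; apply/eqP; rewrite eq_le rdist_tri //=.
apply: le_rdist => // M r.
have [c' fc' le] := face_crossing sw fx fy r x0 y0.
exact: le_trans (cmin _ fc') le.
Qed.

(** * The tube of a wall as a metric product *)

Section Tube.
Variables (L : set (set Y)) (w : set Y).
Hypothesis (aw : away w) (sw : separates L w).

Notation tube := (face (L `|` nested w)).
Notation bottom := (face (L `|` nested w `|` [set w])).

Let Hw : H w. Proof. by case: aw. Qed.

Lemma upd_tube x (c : R) : tube x -> 0 <= c <= 1 -> tube (upd x w c).
Proof.
move=> [wx x0] c01; split.
  by apply: wpoint_upd => // k nk; right; apply: x0; right; [left|right].
move=> h Lh; have [n1 n2] : h <> w /\ h <> ~` w.
  case: Lh => [Lh|/nested_off //]; have [nL nL'] := separates_notin sw.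
  by split=> e; [apply: nL|apply: nL']; rewrite -e.
by rewrite upd_off // x0.
Qed.

Lemma joint_upd_tube x y (c c' : R) : tube x -> tube y -> joint x y -> 0 <= c <= 1 -> 0 <= c' <= 1 ->
  joint (upd x w c) (upd y w c').
Proof.
move=> [_ x0] [_ y0] j c01 c01'; apply: joint_upd => // k dj; right.
  by split; [apply: x0|apply: y0]; right; left.
by split; [apply: x0|apply: y0]; right; right.
Qed.

Lemma sqdist_upd x y (c c' : R) : wpoint x -> wpoint y -> tube (upd x w c) -> tube (upd y w c') ->
  sqdist (upd x w c) (upd y w c') = (c - c') ^+ 2 + sqdist (upd x w 0) (upd y w 0).
Proof.
move=> wx wy fx fy.
rewrite (sqdist_split (x' := upd x w 0) (y' := upd y w 0) (face_wpoint fx) (face_wpoint fy) aw) ?upd_at //.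
by move=> h ah hw; rewrite !(upd_away _ _ aw ah hw).
Qed.

Let z01 : 0 <= (0 : R) <= 1. Proof. by apply/andP; split; lra. Qed.
Let w01 x : wpoint x -> 0 <= x w <= 1.
Proof. by move=> wx; rewrite (wpoint_ge0 _ wx) (wpoint_le1 _ wx). Qed.

(** A route, retracted into the tube, is lifted by letting the coordinate [w] run from [a] to [b] in
    proportion to arc length. *)
Lemma tube_rdist_le u v M (a b : R) : tube !=set0 -> route u v M -> 0 <= a <= 1 -> 0 <= b <= 1 ->
  rdist (upd (gate tube u) w a) (upd (gate tube v) w b) <= Num.sqrt (M ^+ 2 + (a - b) ^+ 2).
Proof.
move=> ne r; have gt x : wpoint x -> tube (gate tube x) by exact: gate_face.
elim: r a b => [x wx|x y z {}M j r IH] a b a01 b01.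
  have j : joint (gate tube x) (gate tube x) by apply: joint_refl; exact: face_wpoint (gt _ wx).
  apply: le_trans (rdist_joint (joint_upd_tube (gt _ wx) (gt _ wx) j a01 b01)) _.
  have wg := face_wpoint (gt _ wx).
  rewrite ler_wsqrtr // sqdist_upd //; try exact: upd_tube (gt _ wx) _.
  by rewrite addrC lerD // expr0n /= /sqdist fsbig1 // => h _; rewrite subrr expr0n.
have [wx wy _] := j; have [_ wz] := route_wpoint r.
have M0 := route_ge0 r; have e0 := edist_ge0 H p x y.
have step c : 0 <= c <= 1 -> rdist (upd (gate tube x) w a) (upd (gate tube y) w c) <=
    Num.sqrt (edist x y ^+ 2 + (a - c) ^+ 2).
  move=> c01.
  have jg := gate_joint (face_wpoint (L := L `|` nested w)) ne j.
  apply: le_trans (rdist_joint (joint_upd_tube (gt _ wx) (gt _ wy) jg a01 c01)) _.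
  have [wgx wgy] := (face_wpoint (gt _ wx), face_wpoint (gt _ wy)).
  rewrite ler_wsqrtr // sqdist_upd //; [|exact: upd_tube (gt _ wx) _|exact: upd_tube (gt _ wy) _].
  rewrite addrC lerD2r sqr_edist; apply: le_trans (gate_sqdist (face_wpoint (L := L `|` nested w)) ne wx wy).
  rewrite (@sqdist_split R Y H p (gate tube x) (gate tube y) (upd (gate tube x) w 0) (upd (gate tube y) w 0) w) ?lerDr ?sqr_ge0 ?upd_at //.
  by move=> h ah hw; rewrite !(upd_away _ _ aw ah hw).
have [c [c01 ec]] : exists c, 0 <= c <= 1 /\
    Num.sqrt (edist x y ^+ 2 + (a - c) ^+ 2) + Num.sqrt (M ^+ 2 + (c - b) ^+ 2) <=
    Num.sqrt ((edist x y + M) ^+ 2 + (a - b) ^+ 2).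
  have /andP[? ?] := a01; have /andP[? ?] := b01.
  have [s0|sn] := eqVneq (edist x y + M) 0.
    have [-> ->] : edist x y = 0 /\ M = 0 by split; lra.
    by exists a; rewrite subrr !addr0 !expr0n /= !add0r sqrtr0 add0r.
  have s0 : 0 < edist x y + M by rewrite lt_neqAle eq_sym sn addr_ge0.
  (* With the height linear in arc length, both right triangles are similar to the large one and
     their hypotenuses add up exactly. *)
  pose t := edist x y / (edist x y + M).
  have t0 : 0 <= t by rewrite divr_ge0 // ltW.
  have t1 : t <= 1 by rewrite ler_pdivrMr // mul1r; lra.
  exists (a + t * (b - a)); split; first by apply/andP; split; nra.
  set D := Num.sqrt ((edist x y + M) ^+ 2 + (a - b) ^+ 2).
  have D2 : D ^+ 2 = (edist x y + M) ^+ 2 + (a - b) ^+ 2 by rewrite sqr_sqrtr // addr_ge0 ?sqr_ge0.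
  have Dge : 0 <= D by exact: sqrtr_ge0.
  have eE : edist x y = t * (edist x y + M) by rewrite /t divfK.
  have eM : M = (1 - t) * (edist x y + M) by rewrite mulrBl mul1r -eE; ring.
  have -> : edist x y ^+ 2 + (a - (a + t * (b - a))) ^+ 2 = (t * D) ^+ 2.
    by rewrite exprMn D2 {1}eE; ring.
  have -> : M ^+ 2 + (a + t * (b - a) - b) ^+ 2 = ((1 - t) * D) ^+ 2.
    by rewrite exprMn D2 {1}eM; ring.
  have tD : 0 <= t * D by exact: mulr_ge0.
  have tD' : 0 <= (1 - t) * D by apply: mulr_ge0 => //; lra.
  by rewrite !sqrtr_sqr (ger0_norm tD) (ger0_norm tD'); lra.
apply: le_trans ec; apply: le_trans (lerD (step c c01) (IH c b c01 b01)).
apply: rdist_tri => //; apply: face_wpoint.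
- by apply: upd_tube a01; exact: gt.
- by apply: upd_tube c01; exact: gt.
- by apply: upd_tube b01; exact: gt.
Qed.

(** Pythagoras. Lifted routes give the upper bound. For the lower one, the right-hand side is itself
    subadditive and bounded by the Euclidean distance on cubes, so it cannot exceed the path
    metric. *)
Lemma tube_rdist x y : tube x -> tube y ->
  rdist x y ^+ 2 = rdist (upd x w 0) (upd y w 0) ^+ 2 + (x w - y w) ^+ 2.
Proof.
move=> fx fy; have ne : tube !=set0 by exists x.
have [wx wy] := (face_wpoint fx, face_wpoint fy).
have gt z : wpoint z -> tube (gate tube z) by exact: gate_face.
have wu z : wpoint z -> wpoint (upd (gate tube z) w 0).
  by move=> wz; apply: face_wpoint (upd_tube (gt _ wz) z01).
have [wx0 wy0] : wpoint (upd x w 0) /\ wpoint (upd y w 0).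
  by split; apply: face_wpoint; apply: upd_tube.
apply/eqP; rewrite eq_le; apply/andP; split.
  suff h : forall M, route (upd x w 0) (upd y w 0) M -> rdist x y <= Num.sqrt (M ^+ 2 + (x w - y w) ^+ 2).
    apply/ler_addgt0Pr => e e0.
    set D := rdist (upd x w 0) (upd y w 0).
    have D0 : 0 <= D by exact: rdist_ge0.
    have [e1 [e10 e1e]] : exists e1, 0 < e1 /\ (D + e1) ^+ 2 <= D ^+ 2 + e.
      (* The increment of the square is [e1 * (2 * D + e1)], at most [e1 * (2 * D + 1)] as soon as
         [e1 <= 1]. *)
      exists (Num.min 1 (e / (2 * D + 1))).
      have q0 : 0 < 2 * D + 1 by lra.
      split; first by rewrite lt_min ltr01 divr_gt0.
      set f := Num.min _ _; have f1 : f <= 1 by rewrite ge_min lexx.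
      have f0 : 0 < f by rewrite lt_min ltr01 divr_gt0.
      have : f * (2 * D + 1) <= e by rewrite -ler_pdivlMr // ge_min lexx orbT.
      nra.
    have [M r lt] := rdist_approx hW wx0 wy0 e10.
    have M0 := route_ge0 r.
    have := h M r => le.
    have : rdist x y ^+ 2 <= M ^+ 2 + (x w - y w) ^+ 2.
      have q : 0 <= M ^+ 2 + (x w - y w) ^+ 2 by rewrite addr_ge0 ?sqr_ge0.
      by rewrite -(sqr_sqrtr q) ler_sqr ?nnegrE ?sqrtr_ge0 //; exact: rdist_ge0.
    have : M ^+ 2 <= (D + e1) ^+ 2 by rewrite ler_sqr ?nnegrE // ?addr_ge0 ?(ltW e10) // ltW.
    lra.
  move=> M r; have := tube_rdist_le ne r (w01 wx) (w01 wy).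
  rewrite !face_gate; try exact: upd_tube.
  by rewrite !upd_upd (upd_id wx Hw) (upd_id wy Hw).
have q : 0 <= rdist (upd x w 0) (upd y w 0) ^+ 2 + (x w - y w) ^+ 2 by rewrite addr_ge0 ?sqr_ge0.
rewrite -(sqr_sqrtr q) ler_sqr ?nnegrE ?sqrtr_ge0 ?rdist_ge0 //.
(* Composing with the gate defines the candidate on all of X, as required to compare it with routes
   that leave the tube. *)
pose F x y := Num.sqrt (rdist (upd (gate tube x) w 0) (upd (gate tube y) w 0) ^+ 2 +
   (gate tube x w - gate tube y w) ^+ 2).
have := @rdist_lower R Y H p hW F; rewrite /F.
move=> /(_ _ _ _ x y wx wy); rewrite !(face_gate fx) !(face_gate fy); apply.
- by move=> z wz; rewrite subrr rdist_refl ?expr0n ?addr0 ?sqrtr0 //; exact: wu.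
- move=> a b c wa wb wc.
  have [[wa' wb'] wc'] := (wu _ wa, wu _ wb, wu _ wc).
  rewrite (_ : gate tube a w - gate tube c w =
    (gate tube a w - gate tube b w) + (gate tube b w - gate tube c w)); last by ring.
  have [r1 r2] := (rdist_ge0 hW wa' wb', rdist_ge0 hW wb' wc').
  apply: le_trans (minkowski2_norm _ _ r1 r2).
  rewrite ler_wsqrtr // lerD2r ler_sqr ?nnegrE ?addr_ge0 ?rdist_ge0 //.
  exact: rdist_tri.
- move=> a b j; have [wa wb _] := j.
  have jg := gate_joint (face_wpoint (L := L `|` nested w)) ne j.
  have ju := joint_upd_tube (gt _ wa) (gt _ wb) jg z01 z01.
  rewrite ler_wsqrtr //.
  apply: le_trans (gate_sqdist (face_wpoint (L := L `|` nested w)) ne wa wb).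
  have [wga wgb] := (face_wpoint (gt _ wa), face_wpoint (gt _ wb)).
  rewrite (@sqdist_split R Y H p (gate tube a) (gate tube b)
    (upd (gate tube a) w 0) (upd (gate tube b) w 0) w) ?upd_at //; last first.
    by move=> h ah hw; rewrite !(upd_away _ _ aw ah hw).
  rewrite addrC lerD2l -sqr_edist ler_sqr ?nnegrE ?edist_ge0 //; first exact: rdist_joint.
  by apply: rdist_ge0 => //; exact: wu.
Qed.

(** The CN inequality of the bottom is added to the corresponding identity on the segment, where the
    [w]-coordinate is interpolated affinely. *)
Lemma tube_cn : cn_space rdist bottom -> cn_space rdist tube.
Proof.
move=> cnK q r l fq fr l01.
have bot x : tube x -> bottom (upd x w 0).
  move=> fx; have [wu u0] := upd_tube fx z01; split=> // h [/u0 //|->].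
  by rewrite upd_at.
have [m0 fm0 cm0] := cnK _ _ l (bot _ fq) (bot _ fr) l01.
have [wq wr] := (face_wpoint fq, face_wpoint fr).
have /andP[l0 l1] := l01.
have c01 : 0 <= (1 - l) * q w + l * r w <= 1.
  have /andP[? ?] := w01 wq; have /andP[? ?] := w01 wr.
  by apply/andP; split; nra.
have tm0 : tube m0 by apply: face_subset fm0 => h; left.
exists (upd m0 w ((1 - l) * q w + l * r w)); first exact: upd_tube.
move=> x fx; have := cm0 _ (bot _ fx).
rewrite (tube_rdist fx (upd_tube tm0 c01)) (tube_rdist fx fq) (tube_rdist fx fr) (tube_rdist fq fr).
have m00 : upd m0 w 0 = m0.
  have <- : m0 w = 0 by case: fm0 => _; apply; right.
  by apply: (upd_id (face_wpoint fm0)).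
by rewrite upd_upd m00 upd_at; lra.
Qed.

End Tube.

Lemma face_cn L (s : list (set Y)) : (forall h, separates L h -> away h -> h \in s) ->
  cn_space rdist (face L).
Proof.
move eN : (size s) => n; elim: n s L eN => [|n IH] s L eN sP.
  (* No wall separates the face, so it has at most one point. *)
  move=> q r l fq fr _; suff -> : q = r.
    exists r => // x fx; have wr := face_wpoint fr; rewrite (rdist_refl hW wr); lra.
  have [wq wr] := (face_wpoint fq, face_wpoint fr).
  apply: (wpoint_eq hW wq wr) => h ah; apply: contrapT => ne.
  have : h \in s; last by rewrite (size0nil eN).
  apply: sP => //; have [Hh _] := ah; split=> //.
    by have [q0|q0] := pselect (q h = 0); [exists r => // r0; apply: ne; rewrite q0 r0|exists q].
  by have [q0|q0] := pselect (q h = 1); [exists r => // r0; apply: ne; rewrite q0 r0|exists q].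
have [[w [sw aw]]|none] := pselect (exists w, separates L w /\ away w); last first.
  apply: (IH (behead s)); first by rewrite size_behead eN.
  by move=> h sh ah; case: none; exists h.
have [Hw _ _] := sw; have ws : w \in s by exact: sP.
(* Making a side of [w] vanish renders [w] constant on the face, so [w] can be struck off the
   list. *)
have cnL' L' w' : L `<=` L' -> (w' = w \/ w' = ~` w) -> L' w' -> cn_space rdist (face L').
  move=> LL' ww Lw; apply: (IH (rem w s)); first by rewrite size_rem // eN.
  move=> h sh ah; have := sP h (separates_subset LL' sh) ah.
  rewrite (perm_mem (perm_to_rem ws)) inE => /orP[/eqP e|//].
  have [n1 n2] := separates_notin sh.
  by case: ww => ww; [case: n1|case: n2]; rewrite e -ww.
pose A := face (L `|` [set w]); pose B := face (L `|` [set ~` w]).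
pose T := face (L `|` nested w).
pose K0 := face (L `|` nested w `|` [set w]); pose K1 := face (L `|` nested w `|` [set ~` w]).
have cA : cn_space rdist A by apply: (cnL' _ w); [move=> h; left|left|right].
have cB : cn_space rdist B by apply: (cnL' _ (~` w)); [move=> h; left|right|right].
have cK0 : cn_space rdist K0 by apply: (cnL' _ w); [move=> h; left; left|left|right].
have cK1 : cn_space rdist K1 by apply: (cnL' _ (~` w)); [move=> h; left; left|right|right].
have cT : cn_space rdist T by exact: tube_cn.
have met := rdist_metric hW (p := p) (R := R).
have convex L' : cn_space rdist (face L') -> forall c c' (l : R), face L' c -> face L' c' -> 0 <= l <= 1 ->
    exists m, [/\ face L' m, rdist c m = l * rdist c c' & rdist m c' = (1 - l) * rdist c c'].
  move=> cn c c' l fc fc' l01; have [m fm cm] := cn _ _ _ fc fc' l01.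
  by exists m; have [] := cn_point_dist met (@face_wpoint L') fc fc' fm l01 cm.
have K0A : K0 `<=` A by apply: face_subset => h [|->]; [left; left|right].
have K0T : K0 `<=` T by apply: face_subset => h; left.
have K1B : K1 `<=` B by apply: face_subset => h [|->]; [left; left|right].
have K1T : K1 `<=` T by apply: face_subset => h; left.
have AL : A `<=` face L by apply: face_subset => h; left.
have BL : B `<=` face L by apply: face_subset => h; left.
have TL : T `<=` face L by apply: face_subset => h; left.
have gAT : gluing wpoint rdist A T K0.
  split=> //; try exact: face_wpoint; first exact: convex.
  move=> x y Ax Ty; have [y0|yn] := pselect (y w = 0).
    exists y; last by rewrite rdist_refl ?addr0 //; exact: face_wpoint Ty.
    by case: Ty => wy y00; split=> // h [/y00 //|->].
  by apply: (face_through sP) => //; [exact: AL|exact: TL|case: Ax => _; apply; right].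
have cU := glue_cn_space met gAT.
have UX : A `|` T `<=` wpoint by move=> x [] /face_wpoint.
have UL : A `|` T `<=` face L by move=> x [/AL|/TL].
have gUB : gluing wpoint rdist (A `|` T) B K1.
  split=> //; try exact: face_wpoint; [by move=> x /K1T; right|exact: convex|].
  move=> x y Ux By; have [wx wy] := (UX _ Ux, face_wpoint By).
  have y0 : y (~` w) = 0 by case: By => _; apply; right.
  (* Here [x] has weight 1 on [w], which is impossible in [A]; so [x] belongs to the tube and
     already lies in [K1]. *)
  have [x1|xn] := pselect (x (~` w) = 0).
    exists x; last by rewrite rdist_refl ?add0r.
    have [wx' x00] : T x.
      case: Ux => // -[_ x0]; have := x0 w; rewrite (wpointC wx Hw) in x1.
      by move=> /(_ ltac:(by right)) e; move: x1; rewrite e; lra.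
    by split=> // h [/x00 //|->].
  have [c Kc e] := face_through sP (separatesC sw) (BL _ By) (UL _ Ux) y0 xn.
  rewrite nestedC in Kc; have wc := face_wpoint Kc.
  by exists c => //; rewrite (rdist_sym hW wx wy) e addrC (rdist_sym hW wx wc) (rdist_sym hW wc wy).
have -> : face L = A `|` T `|` B.
  apply/seteqP; split=> [x [wx x0]|x [/UL|/BL] //].
  have [xw|xw] := pselect (x w = 0); first by left; left; split=> // h [/x0|->].
  have [xw'|xw'] := pselect (x (~` w) = 0); first by right; split=> // h [/x0|->].
  (* A weight strictly between 0 and 1 on [w] forces every nested half-space to vanish, so the point
     lies in the tube. *)
  left; right; split=> // h [/x0 //|[] dj]; have [_ _ _ /(_ _ _ dj) [//|//]] := wx.
exact: glue_cn_space gUB.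
Qed.

End Faces.

(** * From the CN inequality to CAT(0) *)

Section CAT0.
Context {R : realType} {T : Type}.
Variables (X : set T) (d : T -> T -> R).
Hypothesis (hd : is_metric_on X d) (cn : cn_space d X).

Lemma cn_geodesic x y : X x -> X y -> exists g, is_geodesic X d x y g.
Proof.
move=> Xx Xy; have D0 := metric_ge0 hd Xx Xy.
have [e|Dn] := eqVneq (d x y) 0.
  exists (fun=> x); rewrite /is_geodesic e; split=> //; first exact: (metric_eq0 hd).
  move=> s t /andP[s0 s1] /andP[t0 t1]; split=> //.
  have [-> ->] : s = 0 /\ t = 0 by split; lra.
  by rewrite (metric_refl hd) // subrr normr0.
have Dp : 0 < d x y by rewrite lt_neqAle eq_sym Dn.
have /choice [g gP] : forall t : R, exists m, 0 <= t <= d x y ->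
    X m /\ cn_point d X x y (t / d x y) m.
  move=> t; case: (boolP (0 <= t <= d x y)) => [/andP[t0 t1]|_]; last by exists x.
  have t01 : 0 <= t / d x y <= 1 by rewrite divr_ge0 //= ler_pdivrMr // mul1r.
  by have [m Xm cm] := cn Xx Xy t01; exists m.
have unit (t : R) : 0 <= t <= d x y -> 0 <= t / d x y <= 1.
  by move=> /andP[t0 t1]; rewrite divr_ge0 //= ler_pdivrMr // mul1r.
have gd (s t : R) : 0 <= s <= d x y -> 0 <= t <= d x y -> s <= t -> d (g s) (g t) = t - s.
  move=> hs ht st; have [Xs cs] := gP s hs; have [Xt ct] := gP t ht.
  rewrite (cn_curve_dist hd (@subset_refl _ X) Xx Xy Xs Xt (unit _ hs) (unit _ ht) cs ct).
    by rewrite -mulrBl divfK.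
  by rewrite ler_pM2r // invr_gt0.
have h0 : 0 <= (0 : R) <= d x y by rewrite lexx.
have hD : 0 <= d x y <= d x y by rewrite lexx D0.
exists g; split.
- have [X0 c0] := gP 0 h0.
  have [e _] := cn_point_dist hd (@subset_refl _ X) Xx Xy X0 (unit _ h0) c0.
  by apply/esym/(metric_eq0 hd Xx X0); rewrite e mul0r mul0r.
- have [XD cD] := gP _ hD.
  have [_ e] := cn_point_dist hd (@subset_refl _ X) Xx Xy XD (unit _ hD) cD.
  by apply/(metric_eq0 hd XD Xy); rewrite e divff // subrr mul0r.
move=> s t hs ht; have [Xs _] := gP s hs; have [Xt _] := gP t ht; split=> //.
have [st|ts] := leP s t; first by rewrite (gd s t hs ht st) ler0_norm; lra.
by rewrite (metric_sym hd Xs Xt) (gd t s ht hs (ltW ts)) gtr0_norm; lra.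
Qed.

(** Stewart's inequality is used twice: on [[a,b]] seen from [c], which bounds the distance from
    [g1 s] to [c], then on [[a,c]] seen from [g1 s]. *)
Lemma cn_comparison a b c g1 g2 (s t : R) : X a -> X b -> X c ->
  is_geodesic X d a b g1 -> is_geodesic X d a c g2 -> 0 <= s <= d a b -> 0 <= t <= d a c ->
  d (g1 s) (g2 t) ^+ 2 <= s ^+ 2 + t ^+ 2 -
    s * t * (d a b ^+ 2 + d a c ^+ 2 - d b c ^+ 2) / (d a b * d a c).
Proof.
move=> Xa Xb Xc [g10 g1D g1P] [g20 g2D g2P] hs ht.
have D0 := metric_ge0 hd Xa Xb; have E0 := metric_ge0 hd Xa Xc.
have h0 : 0 <= (0 : R) <= d a b by rewrite lexx.
have k0 : 0 <= (0 : R) <= d a c by rewrite lexx.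
have hD : 0 <= d a b <= d a b by rewrite lexx D0.
have kD : 0 <= d a c <= d a c by rewrite lexx E0.
have [Xs es] := g1P 0 s h0 hs; have [Xt et] := g2P 0 t k0 ht.
have [Xg1 esD] := g1P s _ hs hD; have [Xg2 etD] := g2P t _ ht kD.
move: es et esD etD; rewrite g10 g20 g1D g2D.
have /andP[s0 s1] := hs; have /andP[t0 t1] := ht.
rewrite !ler0_norm; try lra.
move=> es et esD etD.
(* The cases [s = 0] and [t = 0] also absorb sides of length 0, where the quotient would have
   denominator 0. *)
have [se|sn] := eqVneq s 0.
  have -> : g1 s = a by rewrite se.
  by rewrite et se expr0n /= !mul0r subr0 add0r; nra.
have [te|tn] := eqVneq t 0.
  have -> : g2 t = a by rewrite te.
  by rewrite (metric_sym hd Xg1 Xa) es te expr0n /= mulr0 !mul0r subr0 addr0; nra.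
have sp : 0 < s by rewrite lt_neqAle eq_sym sn.
have tp : 0 < t by rewrite lt_neqAle eq_sym tn.
have Dp : 0 < d a b by lra.
have Ep : 0 < d a c by lra.
have st1 := cn_stewart (p := c) hd (@subset_refl _ X) cn Xc Xa Xg1 Xb ltac:(lra).
have st2 := cn_stewart (p := g1 s) hd (@subset_refl _ X) cn Xg1 Xa Xg2 Xc ltac:(lra).
move: st1 st2; rewrite /stewart esD etD es et (metric_sym hd Xg1 Xa) es.
rewrite (metric_sym hd Xc Xg1) (metric_sym hd Xc Xa) (metric_sym hd Xc Xb).
move: (d a b) (d a c) Dp Ep => D E Dp Ep.
move: (d (g1 s) c) (d b c) (d (g1 s) (g2 t)) => u v w h1 h2.
rewrite -(ler_pM2l (mulr_gt0 Dp Ep)).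
rewrite [X in _ <= X](_ : _ = D * E * (s ^+ 2 + t ^+ 2) - s * t * (D ^+ 2 + E ^+ 2 - v ^+ 2)); last first.
  by field; rewrite !gt_eqF.
have k1 := ler_wpM2l t0 h1; have k2 := ler_wpM2l (ltW Dp) h2.
lra.
Qed.

Lemma cn_CAT0 : CAT0 X d.
Proof.
split; [exact: hd|exact: cn_geodesic|].
by move=> a b c g1 g2 Xa Xb Xc G1 G2 s t hs ht; exact: cn_comparison.
Qed.

End CAT0.

(** * From finite hulls to the whole complex *)

Section Hull.
Context {R : realType} {Y : Type}.
Variables (H : set (set Y)) (p : Y).
Hypothesis hW : space_with_walls H.

(* The smallest face containing finitely many points has finitely many separating
   walls; geodesic points computed in nested hulls agree by uniqueness. *)
Lemma wpoint_cn : cn_space (@rdist R Y H p) (@wpoint R Y H p).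
Proof.
have met := @rdist_metric R Y H p hW.
pose L (q r x : set Y -> R) := [set h | q h = 0 /\ r h = 0 /\ x h = 0].
have hull q r x : wpoint H p q -> wpoint H p r -> wpoint H p x -> cn_space (@rdist R Y H p) (@face R Y H p (L q r x)).
  move=> wq wr wx.
  have : finite_set ([set h | away H p h /\ q h <> 0] `|` [set h | away H p h /\ r h <> 0] `|`
                     [set h | away H p h /\ x h <> 0]).
    by rewrite !finite_setU; case: wq; case: wr; case: wx.
  move=> /finite_seqP[s es]; suff sP h : separates (R := R) H p (L q r x) h -> away H p h -> h \in s by exact: (face_cn hW sP).
  move=> [_ [z [_ z0] zh] _] ah.
  suff : [set` s] h by [].
  rewrite -es; apply: contrapT => n; apply: zh; apply: z0; rewrite /L /=.
  do ! split; apply: contrapT => nh; apply: n; [left; left|left; right|right] => //.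
move=> q r l wq wr l01.
have fq : @face R Y H p (L q r r) q by split=> // h [].
have fr : @face R Y H p (L q r r) r by split=> // h [_ []].
have [m fm cm] := hull q r r wq wr wr q r l fq fr l01.
have sub z : L q r z `<=` L q r r by move=> h [? []].
have [e1 e2] := cn_point_dist met (@face_wpoint R Y H p _) fq fr fm l01 cm.
exists m; first exact: face_wpoint fm.
move=> x wx.
have fx : @face R Y H p (L q r x) x by split=> // h [_ []].
exact: (cn_point_unique met (@face_wpoint R Y H p _) (hull q r x wq wr wx)
  (face_subset (sub x) fq) (face_subset (sub x) fr) (face_subset (sub x) fm) l01 e1 e2 fx).
Qed.

End Hull.

Lemma InP {T : eqType} (x : T) (s : list T) : In x s <-> x \in s.
Proof.
elim: s => //= y s [IH1 IH2]; rewrite inE; split.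
- by case=> [->|/IH1 ->]; rewrite ?eqxx ?orbT.
- by case/orP => [/eqP ->|/IH2]; [left|right].
Qed.

Lemma NoDupP {T : eqType} (s : list T) : NoDup s <-> uniq s.
Proof.
split; first by elim=> //= x {}s /InP/negP nx _ ->; rewrite nx.
elim: s => [_|x s IH /= /andP[nx us]]; first exact: NoDup_nil.
by constructor; [move=> /InP; rewrite (negPf nx)|exact: IH].
Qed.

(** * Admissible sections, corners and cubes *)

Section Walls.
Context {Y : Type}.
Variables (H : set (set Y)) (p : Y).
Hypothesis hW : space_with_walls H.

Notation away := (@away Y H p).
Notation disj := (@disjoint_halves Y H).
Implicit Types (h k : set Y) (s t : section Y) (v w : set (set Y)).

Lemma wall_self h : wall h h. Proof. by left. Qed.

Lemma wallC h : wall (~` h) = wall h.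
Proof. by apply/seteqP; rewrite /wall setCK; split=> k [] ->; [right|left|right|left]. Qed.

Lemma wall_eq h k : wall h = wall k -> h = k \/ h = ~` k.
Proof. by move=> e; have := wall_self h; rewrite e. Qed.

Lemma wall_of_mem h k : wall h k -> wall k = wall h.
Proof. by case=> ->; rewrite ?wallC. Qed.

Lemma is_wall_wall h : H h -> is_wall H (wall h). Proof. by exists h. Qed.

Lemma is_wall_away w : is_wall H w -> exists2 h, away h & w = wall h.
Proof.
by move=> [h Hh ->]; case: (away_or p hW Hh) => ah; [exists h|exists (~` h)] => //; rewrite wallC.
Qed.

Lemma disjoint_halvesE h k : H h -> H k -> wall h <> wall k -> h `&` k = set0 -> disj h k.
Proof. by move=> Hh Hk ne e; split=> // e'; apply: ne; rewrite e' wallC. Qed.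

Lemma disjoint_halves_wall h k : disj h k -> wall h <> wall k.
Proof.
move=> dj; have n := disjoint_halves_neq hW dj; have [_ _ _ n'] := dj.
by move=> /wall_eq[e|e]; [apply: n|apply: n'; rewrite e setCK].
Qed.

Lemma admissible_mem s h : admissible H s -> H h -> s (wall h) = h \/ s (wall h) = ~` h.
Proof. by move=> [a _] Hh; case: (a _ (is_wall_wall Hh)) => ->; [left|right]. Qed.

Lemma admissible_disj s h k : admissible H s -> disj h k -> s (wall h) = h -> s (wall k) <> k.
Proof.
move=> [_ a] [Hh Hk e _] sh sk; apply: (a _ _ (is_wall_wall Hh) (is_wall_wall Hk)).
by rewrite sh sk; apply/disjoints_subset.
Qed.

Definition section_of (O : set (set Y)) : section Y :=
  fun w => xget set0 [set h | w h /\ O h].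

(** Admissible sections as sets of chosen half-spaces, a form in which they can be prescribed by
    cases. Complements need their own clause because [disj] excludes them. *)
Definition orientation (O : set (set Y)) : Prop :=
  [/\ forall h, H h -> O h \/ O (~` h), forall h, H h -> O h -> ~ O (~` h) &
      forall h k, disj h k -> O h -> ~ O k].

Lemma section_of_wall O h : orientation O -> H h -> O h -> section_of O (wall h) = h.
Proof.
move=> [_ ex _] Hh Oh; apply: xget_unique; first by split=> //; left.
by move=> k [[-> //|->] /(ex _ Hh Oh)].
Qed.

Lemma section_ofE O h : orientation O -> H h -> section_of O (wall h) = h <-> O h.
Proof.
move=> oO Hh; split; last exact: section_of_wall.
have [or ex _] := oO; case: (or _ Hh) => // On.
by rewrite -wallC (section_of_wall oO (halfC hW Hh) On) => /esym/(neq_setC p).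
Qed.

Lemma admissible_section_of O : orientation O -> admissible H (section_of O).
Proof.
move=> oO; have [or ex dj] := oO.
have sel w : is_wall H w -> exists h, [/\ H h, O h, w = wall h & section_of O w = h].
  move=> [h Hh ->]; case: (or _ Hh) => Oh; first by exists h; rewrite section_of_wall.
  have HC := halfC hW Hh.
  by exists (~` h); rewrite -wallC section_of_wall.
split=> [w /sel[h [Hh Oh -> ->]]|w k /sel[h [Hh Oh we ->]] /sel[h' [Hh' Oh' ke ->]]].
  exact: wall_self.
move=> /disjoints_subset e.
have [ee|ne] := pselect (wall h = wall h'); last by apply: (dj h h') => //; exact: disjoint_halvesE.
case: (wall_eq ee) => e'; last by apply: (ex h' Hh' Oh'); rewrite -e'.
by move: e; rewrite e' setIid => h0; have [y] := half_neq0 hW Hh'; rewrite h0.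
Qed.

Definition away_part s : set (set Y) := [set h | away h /\ s (wall h) = h].

Lemma away_part0 s : (forall w, is_wall H w -> s w p) -> away_part s = set0.
Proof.
move=> sp; apply/seteqP; split=> // h [[Hh np] sh].
by apply: np; rewrite -sh; apply: sp; exact: is_wall_wall.
Qed.

(* Flipping s at a minimal half-space not containing p keeps it admissible and
   brings it closer to the section of p. *)
Lemma gamma_of_finite s : admissible H s -> finite_set (away_part s) -> in_Gamma H p s.
Proof.
move=> as_ fs; split=> //; move: fs as_ => /finite_seqP[r er].
have {er} : forall h, away_part s h -> h \in r.
  by move=> h sh; have : [set` r] h by rewrite -er.
move eN : (size r) => n; elim: n r s eN => [|n IH] r s eN sub as_.
  exists s; split; last exact: rt_refl.
  move=> w iw; have [h Hh we] := iw; have [mem _] := as_.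
  apply: contrapT => np; have : w (s w) by exact: mem.
  rewrite {1}we => /wall_of_mem e.
  have Hs : H (s w).
    have : w (s w) by exact: mem.
    by rewrite {1}we => -[->|->] //; exact: halfC.
  have : s w \in r by apply: sub; split=> //; rewrite e -we.
  by rewrite (size0nil eN).
have [ne|none] := pselect (away_part s !=set0); last first.
  by apply: (IH (behead r)) => //; [rewrite size_behead eN|move=> h sh; case: none; exists h].
have fs : finite_set (away_part s).
  by apply: (@sub_finite_set _ _ [set` r]) => // h; exact: sub.
have [h [ah sh] hmin] := exists_minimal_set fs ne.
have [Hh np] := ah.
pose s' : section Y := fun v => if `[<v = wall h>] then ~` h else s v.
have s'h : s' (wall h) = ~` h by rewrite /s' asboolT.
have s'v v : v <> wall h -> s' v = s v by move=> nv; rewrite /s' asboolF.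
have [mem adm] := as_.
have as' : admissible H s'.
  (* A failure of admissibility would put [s v] inside [h], making it a chosen half-space that
     misses [p]; minimality of [h] then gives [v = wall h]. *)
  have key v : is_wall H v -> v <> wall h -> ~ (~` h `<=` ~` (s v)).
    move=> iv nv /subsetC; rewrite !setCK => sub'.
    have [k Hk vk] := iv; have : v (s v) by exact: mem.
    move=> vs; have e : wall (s v) = v by rewrite {2}vk; apply: wall_of_mem; rewrite -vk.
    have Hs : H (s v) by move: vs; rewrite {1}vk => -[->|->] //; exact: halfC.
    apply: nv; rewrite -e; congr wall; apply: hmin => //; split; last by rewrite e.
    by split=> // /sub'.
  split=> [v iv|v k iv ik].
    by have [->|nv] := pselect (v = wall h); [rewrite s'h; right|rewrite s'v //; exact: mem].
  have [->|nv] := pselect (v = wall h); have [->|nk] := pselect (k = wall h).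
  - rewrite s'h setCK => sub'; have [y hy] := half_neq0 hW (halfC hW Hh).
    by have := sub' _ hy.
  - by rewrite s'h (s'v k) //; exact: key.
  - by rewrite s'h (s'v v) // => /subsetC; rewrite setCK; exact: key.
  - by rewrite !s'v //; exact: adm.
have hr : h \in r by apply: sub.
have [||t [tp ts]] := IH (rem h r) s' _ _ as'.
- by rewrite size_rem // eN.
- move=> k [ak sk]; have kh : wall k <> wall h.
    move=> e; move: sk; rewrite e s'h => k'; apply: (awayC ah); rewrite k'.
    exact: ak.
  rewrite s'v // in sk.
  have : k \in r by apply: sub.
  rewrite (perm_mem (perm_to_rem hr)) inE => /orP[/eqP ek|//].
  by case: kh; rewrite ek.
exists t; split=> //; apply: rt_trans ts _; apply: rt_step; split=> //; exists (wall h); split.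
- exact: is_wall_wall.
- by rewrite s'h sh => /esym; exact: (neq_setC p).
- by move=> k _ nk; rewrite s'v.
Qed.

(** The vertex of [p] has empty away part, and an edge of the graph changes it on a single wall. *)
Lemma gamma_finite s : in_Gamma H p s -> finite_set (away_part s).
Proof.
move=> [_ [t [tp r]]]; have : finite_set (away_part t) by rewrite away_part0.
elim: {tp t s} r => // [s t [_ _ [w [[h Hh ->] _ off]]] fs|s t u _ IH1 _ IH2 /IH1/IH2 //].
apply: (@sub_finite_set _ _ (away_part s `|` [set h; ~` h])); last by rewrite finite_setU.
move=> k [ak tk]; have [e|ne] := pselect (wall k = wall h).
  by right; case: (wall_eq e) => ->; [left|right].
by left; split=> //; rewrite off //; apply: is_wall_wall; case: ak.
Qed.

(** Replaces paths in the graph by a finiteness condition, which is how membership in the component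
    is checked from here on. *)
Lemma gammaP s : in_Gamma H p s <-> admissible H s /\ finite_set (away_part s).
Proof.
split=> [g|[]]; last exact: gamma_of_finite.
by split; [case: g|exact: gamma_finite].
Qed.

Definition away_half (w : set (set Y)) : set Y := xget set0 (w `&` away).

Lemma away_half_wall h : away h -> away_half (wall h) = h.
Proof.
move=> ah; apply: xget_unique; first by split=> //; left.
by move=> k [[-> //|->] /(awayC ah)].
Qed.

Lemma finite_away_in (E : list (set (set Y))) : finite_set [set h | away h /\ In (wall h) E].
Proof.
apply: (@sub_finite_set _ _ (away_half @` [set` E])); last exact: finite_image.
by move=> h [ah /InP hE]; exists (wall h) => //; exact: away_half_wall.
Qed.

Lemma crosses_meet h k : crosses H (wall h) (wall k) -> h `&` k !=set0.
Proof.
move=> [h' [k' [_ _ /wall_eq eh /wall_eq ek [a b c d]]]].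
by case: eh => ->; case: ek => ->.
Qed.

(** The predicate [Q] orients the walls of [E] and [B] all others. If every [Q] gives a vertex, all
    vertices of the cube exist; the corner is placed at the one facing [p], and each edge reverses
    [Q] on one wall. *)
Lemma corner_of_orientations (E : list (set (set Y))) (B : set (set Y)) :
  let O Q := [set h | H h /\ (In (wall h) E /\ Q h \/ ~ In (wall h) E /\ B h)] in
  pairwise_crossing H E ->
  (forall Q : set Y -> Prop, (forall h, Q (~` h) <-> ~ Q h) ->
     orientation (O Q) /\ finite_set [set h | away h /\ O Q h]) ->
  corner H p (section_of (O (fun h => h p))) E.
Proof.
move=> O pc OO.
have gam Q : (forall h, Q (~` h) <-> ~ Q h) -> in_Gamma H p (section_of (O Q)).
  move=> /OO[oO fO]; apply/gammaP; split; first exact: admissible_section_of.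
  by apply: sub_finite_set fO => h [ah /(section_ofE oO ah.1)].
have h0 h : (~` h) p <-> ~ h p by [].
have o0 := (OO _ h0).1.
split=> //; first exact: gam.
move=> w wE; have [_ iw _] := pc; have [h ah we] := is_wall_away (iw _ wE).
rewrite we in wE *; have [Hh np] := ah.
pose Q k := if `[<wall k = wall h>] then ~ k p else k p.
have hQ k : Q (~` k) <-> ~ Q k by rewrite /Q wallC; case: asboolP.
have o1 := (OO _ hQ).1.
have fl : flip_at H (section_of (O (fun h => h p))) (section_of (O Q)) (wall h).
  split; first exact: is_wall_wall.
    have -> : section_of (O Q) (wall h) = h.
      by apply/(section_ofE o1 Hh); split=> //; left; split=> //; rewrite /Q asboolT.
    by move=> /(section_ofE o0 Hh) [_ [[_ /np]|[]]].
  move=> u [k Hk ->] ne.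
  have eO k' : wall k' = wall k -> O (fun h => h p) k' -> O Q k'.
    move=> ek [Hk' o]; split=> //; case: o => [[kE q]|]; last by right.
    by left; split=> //; rewrite /Q asboolF // ek.
  have [or _ _] := o0; have HC := halfC hW Hk.
  case: (or _ Hk) => o; first by rewrite (section_of_wall o0 Hk o) (section_of_wall o1 Hk (eO _ erefl o)).
  by rewrite -wallC (section_of_wall o0 HC o) (section_of_wall o1 HC (eO _ (wallC _) o)).
exists (section_of (O Q)); split=> //; first exact: gam.
split; [exact: admissible_section_of|exact: admissible_section_of|].
by exists (wall h).
Qed.

End Walls.

(** * Cubes and chains in terms of weight functions *)

Section CubeComplex.
Context {R : realType} {Y : Type}.
Variables (H : set (set Y)) (p : Y).
Hypothesis hW : space_with_walls H.

Notation pt := (set Y -> R).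
Notation wpoint := (@wpoint R Y H p).
Notation joint := (@joint R Y H p).
Notation away := (@away Y H p).
Notation disj := (@disjoint_halves Y H).
Implicit Types (x y : pt) (h k : set Y) (s : section Y) (E : list (set (set Y))).

Lemma incube_wpoint s E x : incube H p s E x -> 
  [/\ forall h, ~ H h -> x h = 0, forall h, 0 <= x h, forall h, H h -> x (~` h) = 1 - x h &
      finite_set [set h | away h /\ x h <> 0]].
Proof.
move=> [[gs _ _] off on]; have [as_ fs] := (gammaP p hW s).1 gs.
split=> //.
- move=> h; have [Hh|nH] := pselect (H h); last by rewrite off.
  have [oi oo] := on h Hh; have [hE|/oo[o1 o2]] := pselect (In (wall h) E).
    by have [/andP[]] := oi hE.
  by have [/o1 ->|/o2 ->] := pselect (s (wall h) = h).
- move=> h Hh; have [oi oo] := on h Hh; have [hE|nE] := pselect (In (wall h) E).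
    by have [] := oi hE.
  have [o1 o2] := oo nE; have [_ oo'] := on _ (halfC hW Hh).
  rewrite wallC in oo'; have [o1' o2'] := oo' nE.
  case: (admissible_mem as_ Hh) => e.
    rewrite (o1 e) (o2') ?subrr // e; exact: (neq_setC p).
  by rewrite (o1' e) (o2) ?subr0 // e => /esym; exact: (neq_setC p).
- apply: (@sub_finite_set _ _ (away_part H p s `|` [set h | away h /\ In (wall h) E])).
    move=> h [ah xh]; have [hE|nE] := pselect (In (wall h) E); first by right.
    have [_ oo] := on h ah.1; have [_ o2] := oo nE.
    by left; split=> //; apply: contrapT => /o2.
  by rewrite finite_setU; split=> //; exact: finite_away_in.
Qed.

(** Two walls of [E] cross and have no disjoint sides; two walls outside [E] are governed by
    admissibility of [s]; in the mixed case the edge of the corner decides. *)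
Lemma incube_joint s E x y : incube H p s E x -> incube H p s E y -> joint x y.
Proof.
move=> cx cy; have [[gs [nd iw cr] fl] offx onx] := cx; have [_ offy ony] := cy.
have [as_ fs] := (gammaP p hW s).1 gs.
have zero h : H h -> ~ In (wall h) E -> s (wall h) <> h -> x h = 0 /\ y h = 0.
  by move=> Hh nE ns; split; [exact: ((onx h Hh).2 nE).2|exact: ((ony h Hh).2 nE).2].
(* [s] and its neighbour [t] across [wall h] agree on [wall k]. Were [k] chosen, both would have to
   choose the complement of [h] and could not differ there. *)
have half h k : disj h k -> In (wall h) E -> ~ In (wall k) E -> x k = 0 /\ y k = 0.
  move=> dj hE nE; have [Hh Hk _ _] := dj; apply: zero => // sk.
  have [t [[at_ _] _ [_ ne same]]] := fl _ hE.
  have tk : t (wall k) = k.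
    by rewrite -same //; [exact: is_wall_wall|move=> e; apply: nE; rewrite e].
  have dj' := disjoint_halves_sym dj.
  have sh := admissible_disj as_ dj' sk; have th := admissible_disj at_ dj' tk.
  case: (admissible_mem as_ Hh) => // e1; case: (admissible_mem at_ Hh) => // e2.
  by apply: ne; rewrite e1 e2.
have J h k : disj h k -> (x h = 0 /\ y h = 0) \/ (x k = 0 /\ y k = 0).
  move=> dj; have [Hh Hk e _] := dj; have nw := disjoint_halves_wall hW dj.
  have [hE|hE] := pselect (In (wall h) E); have [kE|kE] := pselect (In (wall k) E).
  - by have := crosses_meet (cr _ _ hE kE nw); rewrite e => -[].
  - by right; exact: (half h k).
  - by left; apply: (half k h) => //; exact: disjoint_halves_sym.
  - have [sh|sh] := pselect (s (wall h) = h); last by left; exact: zero.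
    by right; apply: zero => //; exact: (admissible_disj as_ dj).
have [x1 x2 x3 x4] := incube_wpoint cx; have [y1 y2 y3 y4] := incube_wpoint cy.
by split=> //; split=> // h k /J [[]|[]]; [left|right|left|right].
Qed.

(** The coordinate at [s w] and that at the half of [w] missing [p] are equal or complementary,
    which does not affect squared differences. *)
Lemma cube_dist_edist s E x y : incube H p s E x -> incube H p s E y ->
  cube_dist s E x y = edist H p x y.
Proof.
move=> cx cy; have [wx wy _] := incube_joint cx cy.
have [[gs [nd iw cr] fl] offx onx] := cx; have [_ offy ony] := cy.
have [as_ fs] := (gammaP p hW s).1 gs.
have repE w : In w E -> away (away_half H p w) /\ wall (away_half H p w) = w.
  move=> /iw /(is_wall_away p hW)[h ah ->]; rewrite away_half_wall //.
congr Num.sqrt; rewrite (@sqdist_seq R Y H p x y [seq away_half H p w | w <- E]).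
- rewrite big_map !big_seq; apply: eq_bigr => w /InP wE.
  have [[Hh _] e] := repE _ wE; rewrite -{1 2}e.
  case: (admissible_mem as_ Hh) => -> //.
  by rewrite (wpointC wx Hh) (wpointC wy Hh) -sqrrN; congr (_ ^+ 2); ring.
- rewrite map_inj_in_uniq; first exact/NoDupP.
  by move=> v w /InP /repE[_ e1] /InP /repE[_ e2] e; rewrite -e1 -e2 e.
- by move=> h /mapP[w /InP /repE[? _] ->].
- move=> h ah nE; have nE' : ~ In (wall h) E.
    move=> hE; move/negP: nE; apply; apply/mapP; exists (wall h); first exact/InP.
    by rewrite away_half_wall.
  have [_ /(_ nE')[x1 x2]] := onx h ah.1; have [_ /(_ nE')[y1 y2]] := ony h ah.1.
  by have [sh|sh] := pselect (s (wall h) = h); [rewrite x1 ?y1|rewrite x2 ?y2].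
Qed.

(** [E] collects the walls on which the points differ or are not 0/1-valued. Disjoint half-spaces
    are never both free, so these walls cross pairwise; every other wall is oriented by its weight
    1. *)
Lemma joint_incube x y : joint x y -> exists s E, incube H p s E x /\ incube H p s E y.
Proof.
move=> [wx wy j].
pose free h := ~ (x h = y h /\ (x h = 0 \/ x h = 1)).
have freeC h : H h -> free (~` h) <-> free h.
  move=> Hh; rewrite /free (wpointC wx Hh) (wpointC wy Hh).
  have tr (a b : R) : (1 - a = 1 - b /\ (1 - a = 0 \/ 1 - a = 1)) <-> (a = b /\ (a = 0 \/ a = 1)).
    by split=> -[e [o|o]]; (split; first lra); [right|left|right|left]; lra.
  by rewrite tr.
have free_disj h k : disj h k -> free h -> ~ free k.
  by move=> /j [[e1 e2] fh _|[e1 e2] _ fk]; [apply: fh|apply: fk]; rewrite e1 e2; split=> //; left.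
have fsupp : finite_set ([set h | away h /\ x h <> 0] `|` [set h | away h /\ y h <> 0]).
  by rewrite finite_setU; case: wx => _ _ _ _ ?; case: wy.
have supp h : away h -> free h \/ x h = 1 ->
    ([set h | away h /\ x h <> 0] `|` [set h | away h /\ y h <> 0]) h.
  move=> ah o; have [x0|x0] := pselect (x h = 0); last by left.
  right; split=> // y0; case: o => [f|]; first by apply: f; rewrite x0 y0; split=> //; left.
  by rewrite x0 => /esym/eqP; rewrite oner_eq0.
have : finite_set [set h | away h /\ free h].
  by apply: sub_finite_set fsupp => h [ah fh]; apply: supp => //; left.
move=> /finite_seqP[r er].
have rP h : h \in r <-> away h /\ free h.
  by change ([set` r] h <-> away h /\ free h); rewrite -er.
pose E := undup [seq wall h | h <- r].
have EP h : H h -> In (wall h) E <-> free h.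
  move=> Hh; rewrite InP mem_undup; split.
    move=> /mapP[k /rP[[Hk _] fk] /wall_eq[->//|->]]; exact/freeC.
  move=> fh; apply/mapP; case: (away_or p hW Hh) => ah; first by exists h => //; apply/rP.
  by exists (~` h); rewrite ?wallC //; apply/rP; split=> //; exact/freeC.
have pc : pairwise_crossing H E.
  have Ewall v : In v E -> exists h, [/\ away h, free h & v = wall h].
    by move=> /InP; rewrite mem_undup => /mapP[h /rP[ah fh] ->]; exists h.
  split; first by apply/NoDupP; exact: undup_uniq.
    by move=> v /Ewall[h [[Hh _] _ ->]]; exact: is_wall_wall.
  move=> v u /Ewall[h [[Hh _] fh ->]] /Ewall[k [[Hk _] fk ->]] ne.
  have meet h' k' : H h' -> H k' -> free h' -> free k' -> wall h' <> wall k' -> h' `&` k' !=set0.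
    move=> Hh' Hk' fh' fk' ne'; apply/set0P/eqP => e.
    exact: (free_disj _ _ (disjoint_halvesE Hh' Hk' ne' e)).
  have [HhC HkC] := (halfC hW Hh, halfC hW Hk).
  have [fhC fkC] : free (~` h) /\ free (~` k) by split; apply/freeC.
  by exists h, k; split=> //; split; apply: meet; rewrite ?wallC.
pose O (Q : set Y -> Prop) : set (set Y) :=
  [set h | H h /\ (In (wall h) E /\ Q h \/ ~ In (wall h) E /\ x h = 1)].
have fixed h : H h -> ~ In (wall h) E -> x h = y h /\ (x h = 0 \/ x h = 1).
  by move=> Hh nE; apply: contrapT => /(EP _ Hh).
have OO Q : (forall h, Q (~` h) <-> ~ Q h) -> orientation H (O Q).
  move=> hQ; split.
  - move=> h Hh; have HC := halfC hW Hh; have [hE|nE] := pselect (In (wall h) E).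
      have [q|nq] := pselect (Q h); first by left; split=> //; left.
      by right; split=> //; left; rewrite wallC; split=> //; exact/hQ.
    have [_ [x0|x1]] := fixed h Hh nE; [right|left]; split=> //; right; rewrite ?wallC; split=> //.
    by rewrite (wpointC wx Hh) x0 subr0.
  - move=> h Hh [_ oh] [_]; rewrite wallC => oc.
    case: oh => [[hE q]|[nE x1]]; case: oc => [[hE' q']|[nE' ]] //; first by move/hQ: q'.
    by rewrite (wpointC wx Hh) x1 subrr => /esym/eqP; rewrite oner_eq0.
  - have key h k : disj h k -> x h = 0 /\ y h = 0 -> ~ O Q h.
      move=> dj [e1 e2] [Hh [[hE _]|[_]]].
        by have := (EP h Hh).1 hE; apply; rewrite e1 e2; split=> //; left.
      by rewrite e1 => /esym/eqP; rewrite oner_eq0.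
    move=> h k dj oh ok; case: (j _ _ dj) => e; first exact: (key h k dj e).
    exact: (key k h (disjoint_halves_sym dj) e).
have o0 : orientation H (O (fun h => h p)) by apply: OO.
have cor : corner H p (section_of (O (fun h => h p))) E.
  apply: (corner_of_orientations hW pc) => Q hQ; split; first exact: OO.
  apply: sub_finite_set fsupp => h [ah [Hh o]]; apply: supp => //.
  by case: o => [[/(EP _ Hh)]|[_]]; [left|right].
have inc z : wpoint z -> (forall h, H h -> ~ In (wall h) E -> z h = x h) ->
    incube H p (section_of (O (fun h => h p))) E z.
  move=> wz ez; split=> //; first by case: wz.
  move=> h Hh; split=> [hE|nE].
    by rewrite (wpoint_ge0 _ wz) (wpoint_le1 _ wz) (wpointC wz Hh).
  rewrite (ez h Hh nE); split=> [/(section_ofE p hW o0 Hh) [_ [[]|[]]] //|ns].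
  have [_ [//|x1]] := fixed h Hh nE; case: ns; apply/(section_ofE p hW o0 Hh).
  by split=> //; right.
exists (section_of (O (fun h => h p))), E; split; first exact: inc.
by apply: inc => // h Hh nE; have [] := fixed h Hh nE.
Qed.

Lemma inXE x : inX H p x <-> wpoint x.
Proof.
split=> [[s [E c]]|wx]; first by have [] := incube_joint c c.
by have [s [E [c _]]] := joint_incube (joint_refl wx); exists s, E.
Qed.

Lemma chain_length_route x y (L : R) : wpoint x -> chain_length H p x y L -> route H p x y L.
Proof.
move=> wx [n [z [c [z0 zn cz ->]]]].
elim: n x wx z c z0 zn cz => [|n IH] x wx z c z0 zn cz.
  by rewrite big_ord0 -zn z0; exact: route_nil.
rewrite big_ord_recl /= -z0.
have [c1 c2] := cz 0%N isT; rewrite (cube_dist_edist c1 c2).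
have j := incube_joint c1 c2; apply: (route_cons j).
have [_ w1 _] := j.
apply: (IH (z 1%N) w1 (fun i => z i.+1) (fun i => c i.+1)) => // i ltin.
exact: (cz i.+1).
Qed.

Lemma route_chain_length x y (L : R) : route H p x y L -> chain_length H p x y L.
Proof.
elim=> [{}x _|{}x {}y z {}L j _ [n [u [c [u0 un cu ->]]]]].
  by exists 0%N, (fun=> x), (fun=> (fun=> set0, [::])); split=> //; rewrite big_ord0.
have [s [E [c1 c2]]] := joint_incube j.
exists n.+1, (fun i => if i is i'.+1 then u i' else x), (fun i => if i is i'.+1 then c i' else (s, E)).
split=> //.
- by move=> [_|i ltin] /=; [rewrite u0|exact: cu].
- by rewrite big_ord_recl /= u0 (cube_dist_edist c1 c2).
Qed.

Lemma dXE x y : wpoint x -> dX H p x y = rdist H p x y.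
Proof.
move=> wx; rewrite /dX /rdist; congr inf; apply/seteqP; split=> L.
- exact: chain_length_route.
- exact: route_chain_length.
Qed.

Theorem CAT0_inX : CAT0 (inX (R := R) H p) (dX H p).
Proof.
have -> : inX (R := R) H p = wpoint by apply/seteqP; split=> x /inXE.
have met := @rdist_metric R Y H p hW.
apply: cn_CAT0.
  by move=> x y z wx wy wz; rewrite !dXE //; exact: met.
move=> q r l wq wr l01; have [m wm cm] := wpoint_cn hW wq wr l01.
by exists m => // x wx; rewrite !dXE //; exact: cm.
Qed.

End CubeComplex.

(** * The group action *)

Section Action.
Context {R : realType} {G Y : Type}.
Variables (H : set (set Y)) (mul : G -> G -> G) (one : G) (inv : G -> G) (act : G -> Y -> Y).
Hypotheses (hW : space_with_walls H) (hG : is_group mul one inv)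
  (hact : is_action mul one act) (hH : acts_on_walls H act).
Variable p : Y.
Implicit Types (g : G) (h k : set Y) (w : set (set Y)) (s : section Y) (x : set Y -> R).

Lemma group_invK g : inv (inv g) = g.
Proof.
have [mA m1 mr iL iR] := hG.
by rewrite -[LHS]mr -(iL g) mA iL m1.
Qed.

Lemma group_invM g (k : G) : inv (mul g k) = mul (inv k) (inv g).
Proof.
have [mA m1 mr iL iR] := hG.
rewrite -[RHS]m1 -(iL (mul g k)) -mA -(mA g k) (mA k) iR m1 iR mr //.
Qed.

Lemma group_inv1 : inv one = one.
Proof. by have [mA m1 mr iL iR] := hG; rewrite -[LHS]mr iL. Qed.

Lemma actK g y : act (inv g) (act g y) = y.
Proof. by have [a1 aM] := hact; have [_ _ _ iL _] := hG; rewrite -aM iL a1. Qed.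

Lemma actKV g y : act g (act (inv g) y) = y.
Proof. by rewrite -{1}(group_invK g) actK. Qed.

Lemma himgE g h y : (act g @` h) y <-> h (act (inv g) y).
Proof. by split=> [[z hz <-]|hy]; [rewrite actK|exists (act (inv g) y); rewrite ?actKV]. Qed.

Lemma himgK g h : act (inv g) @` (act g @` h) = h.
Proof.
by apply/seteqP; split=> y; rewrite !himgE group_invK actK.
Qed.

Lemma himgKV g h : act g @` (act (inv g) @` h) = h.
Proof. by have := himgK (inv g) h; rewrite group_invK. Qed.

Lemma himg_inj g h k : act g @` h = act g @` k -> h = k.
Proof. by move=> e; rewrite -(himgK g h) e himgK. Qed.

Lemma himgC g h : act g @` (~` h) = ~` (act g @` h).
Proof.
by apply/seteqP; split=> y; [move=> /himgE n /himgE|move=> n; apply/himgE => hy; apply: n; exact/himgE].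
Qed.

Lemma himg1 h : act one @` h = h.
Proof. by have [a1 _] := hact; apply/seteqP; split=> y; rewrite himgE group_inv1 a1. Qed.

Lemma himgM g (k : G) h : act (mul g k) @` h = act g @` (act k @` h).
Proof.
have [_ aM] := hact.
by apply/seteqP; split=> y; rewrite !himgE group_invM aM.
Qed.

Lemma himgI g h k : act g @` (h `&` k) = (act g @` h) `&` (act g @` k).
Proof.
by apply/seteqP; split=> y; [move=> /himgE[? ?]; split; exact/himgE|move=> [/himgE ? /himgE ?]; exact/himgE].
Qed.

Lemma half_himg g h : H h -> H (act g @` h).
Proof. by move=> Hh; rewrite -(hH g); exists h. Qed.

Lemma half_himgV g h : H (act g @` h) -> H h.
Proof. by move=> Hh; rewrite -(himgK g h); exact: half_himg. Qed.

Lemma wimg_wall g h : wimg act g (wall h) = wall (act g @` h).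
Proof.
apply/seteqP; split=> k.
  by case=> l [->|->] <-; [left|right; rewrite himgC].
by case=> ->; [exists h => //; left|exists (~` h); rewrite ?himgC //; right].
Qed.

Lemma wimgK g w : wimg act (inv g) (wimg act g w) = w.
Proof.
apply/seteqP; split=> h; last by move=> wh; exists (act g @` h); rewrite ?himgK //; exists h.
by case=> k [l wl <-] <-; rewrite himgK.
Qed.

Lemma wimg_inj g w v : wimg act g w = wimg act g v -> w = v.
Proof. by move=> e; rewrite -(wimgK g w) e wimgK. Qed.

Lemma wimg1 w : wimg act one w = w.
Proof.
apply/seteqP; split=> h; last by move=> wh; exists h; rewrite ?himg1.
by case=> k wk <-; rewrite himg1.
Qed.

Lemma wimgM g (k : G) w : wimg act (mul g k) w = wimg act g (wimg act k w).
Proof.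
apply/seteqP; split=> h.
  by case=> l wl <-; exists (act k @` l); [exists l|rewrite himgM].
by case=> _ [l wl <-] <-; exists l => //; rewrite himgM.
Qed.

Lemma is_wall_wimg g w : is_wall H w -> is_wall H (wimg act g w).
Proof. by move=> [h Hh ->]; rewrite wimg_wall; exact/is_wall_wall/half_himg. Qed.

Lemma crosses_wimg g w v : crosses H w v -> crosses H (wimg act g w) (wimg act g v).
Proof.
move=> [h [k [Hh Hk -> -> [a b c d]]]].
exists (act g @` h), (act g @` k); rewrite !wimg_wall; split=> //; try exact: half_himg.
by rewrite -!himgC -!himgI; split; apply: image_nonempty.
Qed.

Lemma gsec_wimg g s w : gsec inv act g s (wimg act g w) = act g @` (s w).
Proof. by rewrite /gsec wimgK. Qed.

Lemma gsec_wall g s h : gsec inv act g s (wall (act g @` h)) = act g @` (s (wall h)).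
Proof. by rewrite -wimg_wall gsec_wimg. Qed.

Lemma wall_himg g w : is_wall H w -> exists h, H h /\ w = wall (act g @` h).
Proof.
move=> [h Hh ->]; exists (act (inv g) @` h); rewrite himgKV; split=> //.
by apply: (@half_himgV g); rewrite himgKV.
Qed.

Lemma admissible_gsec g s : admissible H s -> admissible H (gsec inv act g s).
Proof.
move=> [mem adm]; split.
  move=> w /(wall_himg g)[h [Hh ->]]; rewrite gsec_wall -wimg_wall.
  by exists (s (wall h)) => //; apply: mem; exact: is_wall_wall.
move=> w v /(wall_himg g)[h [Hh ->]] /(wall_himg g)[k [Hk ->]].
rewrite !gsec_wall -himgC => sub.
apply: (adm _ _ (is_wall_wall Hh) (is_wall_wall Hk)) => y sy.
have : (act g @` s (wall h)) (act g y) by exists y.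
by move=> /sub [z nz e]; rewrite -(actK g y) -e actK.
Qed.

(** Moving [s] also moves the reference point from [p] to [act g p]; the error consists of the
    finitely many half-spaces separating these two points. *)
Lemma gsec_gamma g s : in_Gamma H p s -> in_Gamma H p (gsec inv act g s).
Proof.
move=> /(gammaP p hW)[as_ fs]; apply/(gammaP p hW); split; first exact: admissible_gsec.
have [_ _ _ fin] := hW.
have fw : finite_set [set h | H h /\ h (act g p) /\ ~ h p] by exact: fin.
apply: (@sub_finite_set _ _ ((fun h => act g @` h) @` (away_part H p s) `|`
   [set h | H h /\ h (act g p) /\ ~ h p])); last first.
  by rewrite finite_setU; split=> //; exact: finite_image.
move=> h [[Hh np] e]; have [hg|nhg] := pselect (h (act g p)); first by right.
left; exists (act (inv g) @` h); last exact: himgKV.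
have Hi : H (act (inv g) @` h) by exact: half_himg.
split; first by split=> //; rewrite himgE group_invK.
by apply: (@himg_inj g); rewrite -gsec_wall himgKV.
Qed.

Lemma gsec_edge g s t : gedge H s t -> gedge H (gsec inv act g s) (gsec inv act g t).
Proof.
move=> [as_ at_ [w [iw ne off]]]; split; try exact: admissible_gsec.
exists (wimg act g w); split; first exact: is_wall_wimg.
  by rewrite !gsec_wimg => /himg_inj.
move=> k /(wall_himg g)[h [Hh ->]] nk; rewrite !gsec_wall off //; first exact: is_wall_wall.
by move=> e; apply: nk; rewrite -wimg_wall e.
Qed.

Lemma flip_at_gsec g s t w : flip_at H s t w ->
  flip_at H (gsec inv act g s) (gsec inv act g t) (wimg act g w).
Proof.
move=> [iw ne off]; split; first exact: is_wall_wimg.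
  by rewrite !gsec_wimg => /himg_inj.
move=> k /(wall_himg g)[h [Hh ->]] nk; rewrite !gsec_wall off //; first exact: is_wall_wall.
by move=> e; apply: nk; rewrite -wimg_wall e.
Qed.

Lemma gsec1 s w : gsec inv act one s w = s w.
Proof. by rewrite /gsec himg1 group_inv1 wimg1. Qed.

Lemma gsecM g (k : G) s w : gsec inv act (mul g k) s w = gsec inv act g (gsec inv act k s) w.
Proof. by rewrite /gsec himgM group_invM wimgM. Qed.

Lemma actX1 x : actX inv act one x = x.
Proof. by apply/funext => h; rewrite /actX group_inv1 himg1. Qed.

Lemma actXM g (k : G) x : actX inv act (mul g k) x = actX inv act g (actX inv act k x).
Proof. by apply/funext => h; rewrite /actX group_invM himgM. Qed.

Lemma actX_himg g x h : actX inv act g x (act g @` h) = x h.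
Proof. by rewrite /actX himgK. Qed.

Lemma actX_vpt g s : actX (R := R) inv act g (vpt H s) = vpt H (gsec inv act g s).
Proof.
apply/funext => h; rewrite -(himgKV g h); move: (act (inv g) @` h) => {}h.
rewrite actX_himg /vpt; congr (if _ then _ else _); apply: asbool_equiv_eq.
rewrite gsec_wall; split=> [[Hh ->]|[Hh /himg_inj e]]; split=> //; first exact: half_himg.
exact: half_himgV Hh.
Qed.

Lemma In_wimg g w (E : list (set (set Y))) : In (wimg act g w) (List.map (wimg act g) E) <-> In w E.
Proof.
split=> [/in_map_iff[v [/wimg_inj -> //]]|]; exact: in_map.
Qed.

Lemma pairwise_crossing_wimg g (E : list (set (set Y))) :
  pairwise_crossing H E -> pairwise_crossing H (List.map (wimg act g) E).
Proof.
move=> [nd iw cr]; split.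
- elim: nd => [|w E' nw _ IH]; first exact: NoDup_nil.
  by apply: NoDup_cons => //; rewrite In_wimg.
- by move=> w /in_map_iff[v [<- vE]]; exact/is_wall_wimg/iw.
- move=> w u /in_map_iff[v [<- vE]] /in_map_iff[v' [<- vE']] ne.
  by apply/crosses_wimg/cr => // e; apply: ne; rewrite e.
Qed.

Lemma corner_gsec g s (E : list (set (set Y))) : corner H p s E ->
  corner H p (gsec inv act g s) (List.map (wimg act g) E).
Proof.
move=> [gs pc fl]; split; [exact: gsec_gamma|exact: pairwise_crossing_wimg|].
move=> w /in_map_iff[v [<- vE]]; have [t [gt ed ft]] := fl _ vE.
exists (gsec inv act g t); split; [exact: gsec_gamma|exact: gsec_edge|exact: flip_at_gsec].
Qed.

Lemma incube_actX g s (E : list (set (set Y))) x : incube H p s E x ->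
  incube H p (gsec inv act g s) (List.map (wimg act g) E) (actX inv act g x).
Proof.
move=> [co off on]; split; first exact: corner_gsec.
- by move=> h nH; rewrite /actX off // => Hi; apply: nH; rewrite -(himgKV g h); exact: half_himg.
move=> h; rewrite -(himgKV g h); move: (act (inv g) @` h) => {}h /half_himgV Hh.
rewrite -himgC !actX_himg -wimg_wall In_wimg wimg_wall gsec_wall.
have [oi oo] := on h Hh; split=> // nE; have [o1 o2] := oo nE.
by split=> [/himg_inj //|ne]; apply: o2 => e; apply: ne; rewrite e.
Qed.

Lemma inX_actX g x : inX H p x -> inX H p (actX inv act g x).
Proof. by move=> [s [E c]]; exists (gsec inv act g s), (List.map (wimg act g) E); exact: incube_actX. Qed.

Lemma cube_dist_actX g s (E : list (set (set Y))) x y :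
  cube_dist (gsec inv act g s) (List.map (wimg act g) E) (actX inv act g x) (actX inv act g y) =
  cube_dist s E x y.
Proof.
congr Num.sqrt; elim: E => [|w E IH]; first by rewrite !big_nil.
by rewrite /= !big_cons IH gsec_wimg !actX_himg.
Qed.

Lemma chain_length_actX g x y (L : R) : chain_length H p x y L ->
  chain_length H p (actX inv act g x) (actX inv act g y) L.
Proof.
move=> [n [z [c [<- <- cz ->]]]].
exists n, (fun i => actX inv act g (z i)),
  (fun i => (gsec inv act g (c i).1, List.map (wimg act g) (c i).2)); split=> //.
- by move=> i /cz[c1 c2]; split; exact: incube_actX.
- by apply: eq_bigr => i _; rewrite cube_dist_actX.
Qed.

Lemma dX_actX g x y : dX H p (actX inv act g x) (actX inv act g y) = dX H p x y.
Proof.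
have K z : actX inv act (inv g) (actX (R := R) inv act g z) = z.
  by rewrite -actXM; have [_ _ _ -> _] := hG; rewrite actX1.
congr inf; apply/seteqP; split=> L; last exact: chain_length_actX.
by move=> /(@chain_length_actX (inv g)); rewrite !K.
Qed.

Lemma wpoint_base : wpoint H p (fun h => if `[<H h /\ h p>] then 1 else 0 : R).
Proof.
split.
- by move=> h nH; rewrite asboolF // => -[].
- by move=> h _; case: asboolP.
- move=> h Hh; case: (asboolP (H h /\ h p)) => [[_ hp]|n].
    by rewrite asboolF ?subrr // => -[_].
  by rewrite asboolT ?subr0 //; split; [exact: halfC|move=> hp; exact: n].
- move=> h k [Hh Hk e _]; case: asboolP => [[_ hp]|_]; last by left.
  right; rewrite asboolF // => -[_ kp]; have : (h `&` k) p by [].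
  by rewrite e.
- rewrite (_ : [set h | _] = set0) //; apply/seteqP; split=> // h [[Hh np]].
  by rewrite asboolF // => -[].
Qed.

(** At the base vertex [b], each wall separating [act g p] from [p] contributes 1 to a squared
    distance, so the displacement is at least the root of their number. By isometry, passing to [x]
    costs at most [2 * D]. *)
Lemma proper_actX x : proper_on_walls H act -> inX H p x -> forall gs : nat -> G, leaves_finite gs ->
  forall M : R, exists N, forall n, (N <= n)%N -> M <= dX H p (actX inv act (gs n) x) x.
Proof.
move=> hp /(inXE p hW) wx gs lf M.
pose b : set Y -> R := fun h => if `[<H h /\ h p>] then 1 else 0.
have wb : wpoint H p b := wpoint_base.
pose D := rdist H p x b; have D0 : 0 <= D := rdist_ge0 hW wx wb.
have [m hm] : exists m : nat, (`|M| + 2 * D) ^+ 2 <= m%:R.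
  by exists (Num.truncn ((`|M| + 2 * D) ^+ 2)).+1; exact/ltW/truncnS_gt.
have [N hN] := hp p gs lf m; exists N => n /hN[E [sE nd sep]].
set g := gs n in sep *.
have act_w (z : set Y -> R) : wpoint H p z -> wpoint H p (actX inv act g z).
  by move=> wz; apply/(inXE p hW); apply: inX_actX; exact/(inXE p hW).
have [wgx wgb] := (act_w _ wx, act_w _ wb).
rewrite (dXE hW _ wgx).
have iso : rdist H p (actX inv act g x) (actX inv act g b) = D.
  by rewrite -(dXE hW _ wgx) dX_actX (dXE hW _ wx).
have t1 := rdist_tri hW wgb wgx wb; have t2 := rdist_tri hW wgx wx wb.
rewrite (rdist_sym hW wgb wgx) iso in t1.
have : Num.sqrt (\sum_(h <- E) (actX inv act g b h - b h) ^+ 2) <= rdist H p (actX inv act g b) b.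
  apply: (l2_le_rdist hW wgb wb); first exact/NoDupP.
  by move=> h /InP /sep[].
have -> : \sum_(h <- E) (actX inv act g b h - b h) ^+ 2 = m%:R.
  rewrite big_seq (eq_bigr (fun=> 1)).
    rewrite -big_seq big_const_seq count_predT iter_addr_0; congr _%:R; exact: sE.
  move=> h /InP /sep[Hh hg np]; rewrite /actX /b asboolT.
    by rewrite asboolF ?subr0 ?expr1n // => -[].
  by split; [exact: half_himg|rewrite himgE group_invK].
have M0 := normr_ge0 M; have MM := ler_norm M.
have : `|M| + 2 * D <= Num.sqrt m%:R.
  rewrite -(ger0_norm (_ : 0 <= `|M| + 2 * D)); last by lra.
  by rewrite -sqrtr_sqr ler_wsqrtr.
move: t1 t2; rewrite -/D; lra.
Qed.

End Action.

(** * Dimension *)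

Section Dimension.
Context {Y : Type}.
Variables (H : set (set Y)) (p : Y).
Hypothesis hW : space_with_walls H.

Notation away := (@away Y H p).
Notation disj := (@disjoint_halves Y H).

Lemma crosses_sym v w : crosses H v w -> crosses H w v.
Proof.
move=> [h [k [Hh Hk -> -> [a b c e]]]]; exists k, h; split=> //.
by rewrite ![k `&` _]setIC ![~` k `&` _]setIC.
Qed.

(* A wall outside a maximal crossing family fails to cross some wall of the family,
   so one of its sides contains a side b of that wall. Every section that allows
   flipping the walls of the family must choose the side containing b. *)
Lemma maximal_crossing_corner (E : list (set (set Y))) : pairwise_crossing H E -> E <> [::] ->
  (forall E', pairwise_crossing H E' -> (length E' <= length E)%N) ->
  exists s, corner H p s E.
Proof.
move=> pc E0 Emax; have [nd iw cr] := pc.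
pose B a := exists b, [/\ H b, In (wall b) E & b `<=` a].
exists (section_of [set h | H h /\ (In (wall h) E /\ h p \/ ~ In (wall h) E /\ B h)]).
apply: (corner_of_orientations hW pc) => Q hQ.
have meet b b' : H b' -> In (wall b) E -> In (wall b') E -> b <> ~` b' -> b `&` b' !=set0.
  move=> Hb' bE bE' ne; have [e|nw] := pselect (wall b = wall b'); last exact: crosses_meet (cr _ _ bE bE' nw).
  by case: (wall_eq e) => // ->; rewrite setIid; exact: (half_neq0 hW).
(* Otherwise [wall a] would cross every wall of [E] and could be added to the family. *)
have total a : H a -> ~ In (wall a) E -> B a \/ B (~` a).
  move=> Ha nE; apply: contrapT => /not_orP[n1 n2].
  suff : pairwise_crossing H (wall a :: E) by move=> /Emax; rewrite /= ltnn.
  have ca w : In w E -> crosses H (wall a) w.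
    move=> wE; have [b Hb we] := iw _ wE; rewrite we in wE *; have HbC := halfC hW Hb.
    exists a, b; split=> //.
    have key c b' : (c = a \/ c = ~` a) -> H b' -> wall b' = wall b -> c `&` b' !=set0.
      move=> ca Hb' e; apply/set0P/eqP => ce.
      have sub : b' `<=` ~` c by move=> y by_ cy; have : (c `&` b') y by []; rewrite ce.
      by case: ca => ca; [apply: n2|apply: n1]; exists b'; split; rewrite ?e // -?ca // -(setCK a) -ca.
    by split; apply: key; rewrite ?wallC //; [left|left|right|right].
  split.
  - exact: NoDup_cons.
  - by move=> w [<-|/iw //]; exact: is_wall_wall.
  - by move=> w v [<-|wE] [<-|vE] ne //; [exact: ca|exact/crosses_sym/ca|exact: cr].
split; first split.
- move=> h Hh; have HC := halfC hW Hh; have [hE|nE] := pselect (In (wall h) E).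
    have [q|nq] := pselect (Q h); first by left; split=> //; left.
    by right; split=> //; left; rewrite wallC; split=> //; exact/hQ.
  case: (total _ Hh nE) => b; first by left; split=> //; right.
  by right; split=> //; right; rewrite wallC.
- move=> h Hh [_ oh] [_]; rewrite wallC => oc.
  case: oh => [[hE q]|[nE [b [Hb bE bh]]]]; case: oc => [[hE' q']|[nE' [b' [Hb' bE' bh']]]] //.
    by move/hQ: q'.
  (* [b] lies in [h] and [b'] in its complement. If they are complementary, [h] is squeezed between
     [b] and itself, so its wall is in [E]; otherwise they meet, which is absurd. *)
  have [e|ne] := pselect (b = ~` b').
    apply: nE; suff -> : h = b by [].
    apply/seteqP; split=> // y hy; rewrite e => /bh'; exact.
  by have [y [/bh hy /bh']] := meet b b' Hb' bE bE' ne; apply.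
- have key h k : disj h k -> In (wall h) E -> ~ In (wall k) E -> ~ B k.
    move=> [Hh Hk e nk] hE _ [b [Hb bE bk]].
    have [e'|ne] := pselect (h = ~` b).
      apply: nk; apply/seteqP; split; first by move=> y ky hy; have : (h `&` k) y by []; rewrite e.
      by rewrite e' setCK.
    have [y [hy /bk ky]] := meet h b Hb hE bE ne.
    by have : (h `&` k) y by []; rewrite e.
  move=> h k dj [Hh oh] [Hk ok]; have [_ _ e nk] := dj.
  case: oh => [[hE _]|[nE bh]]; case: ok => [[kE _]|[nE' bk]].
  + by have := crosses_meet (cr _ _ hE kE (disjoint_halves_wall hW dj)); rewrite e => -[].
  + exact: (key h k dj).
  + exact: (key k h (disjoint_halves_sym dj)).
  + move: bh bk => [b [Hb bE bh]] [b' [Hb' bE' bk]].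
    have [e'|ne] := pselect (b = ~` b'); last first.
      have [y [/bh hy /bk ky]] := meet b b' Hb' bE bE' ne.
      by have : (h `&` k) y by []; rewrite e.
    apply: nE; suff -> : h = b by [].
    apply/seteqP; split=> // y hy; rewrite e' => /bk ky.
    by have : (h `&` k) y by []; rewrite e.
(* For finiteness: a half-space that contains [b] and misses [p] separates the chosen point of [b]
   from [p], and only finitely many [b] occur. *)
have /choice[pick pickP] : forall b : set Y, exists y, H b -> b y.
  by move=> b; have [/(half_neq0 hW)[y yb]|nH] := pselect (H b); [exists y|exists p].
pose S := [set b | H b /\ In (wall b) E].
have fS : finite_set S.
  have fA := finite_away_in H p E.
  apply: (@sub_finite_set _ _ ([set h | away h /\ In (wall h) E] `|`
     setC @` [set h | away h /\ In (wall h) E])); last first.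
    by rewrite finite_setU; split=> //; exact: finite_image.
  move=> b [Hb bE]; case: (away_or p hW Hb) => ab; first by left.
  by right; exists (~` b); rewrite ?setCK //; split=> //; rewrite wallC.
have [_ _ _ fin] := hW.
apply: (@sub_finite_set _ _ ([set h | away h /\ In (wall h) E] `|`
   \bigcup_(b in S) [set h | H h /\ h (pick b) /\ ~ h p])).
  move=> h [[Hh np] [_ [[hE _]|[nE [b [Hb bE bh]]]]]]; first by left.
  right; exists b => //; split=> //; split=> //; apply: bh.
  exact: pickP.
rewrite finite_setU; split; first exact: finite_away_in.
by apply: bigcup_finite => // b _; exact: fin.
Qed.

(** Corners are labelled by crossing families, which bounds the dimension; a family of maximal size
    is realised by a corner. *)
Lemma dimension_crossing n : I_is H n -> dim_is H p n.
Proof.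
move=> [[E [<- pc]] Emax]; split; last first.
  by move=> s E' [_ pc' _]; apply: Emax; exists E'.
have E0 : E <> [::].
  move=> e; have [[h Hh] _ _ _] := hW; suff : I_ge H 1 by move=> /Emax; rewrite e.
  exists [:: wall h]; split=> //; split.
  - by apply: NoDup_cons => //; exact: NoDup_nil.
  - by move=> w [<-|//]; exact: is_wall_wall.
  - by move=> w k [<-|//] [<-|//].
have [s cs] := maximal_crossing_corner pc E0 (fun E' pc' => Emax _ (ex_intro _ E' (conj erefl pc'))).
by exists s, E.
Qed.

End Dimension.

Unset Implicit Arguments.
Set Strict Implicit.

Theorem mainTheorem2 (R : realType) (Y : Type) (H : set (set Y))
  (G : Type) (mul : G -> G -> G) (one : G) (inv : G -> G)
  (act : G -> Y -> Y)
  (hW : space_with_walls H)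
  (hG : is_group mul one inv)
  (hact : is_action mul one act)
  (hHinv : acts_on_walls H act)
  (hprop : proper_on_walls H act)
  (p : Y) :
  (* X is a CAT(0) cube complex *)
  CAT0 (inX (R := R) H p) (dX H p) /\
  (* the formula (g s)(w) = g (s (g^-1 w)) defines an action on the vertices *)
  (forall g s, in_Gamma H p s -> in_Gamma H p (gsec inv act g s)) /\
  (forall s w, in_Gamma H p s -> is_wall H w -> gsec inv act one s w = s w) /\
  (forall g k s w, in_Gamma H p s -> is_wall H w ->
     gsec inv act (mul g k) s w = gsec inv act g (gsec inv act k s) w) /\
  (* which extends to an action on X by cellular isometries *)
  (forall g s, in_Gamma H p s ->
     actX inv act g (vpt (R := R) H s) = vpt H (gsec inv act g s)) /\
  (forall g x, inX H p x -> inX (R := R) H p (actX inv act g x)) /\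
  (forall x, inX H p x -> actX (R := R) inv act one x = x) /\
  (forall g k x, inX H p x ->
     actX (R := R) inv act (mul g k) x = actX inv act g (actX inv act k x)) /\
  (forall g s E x, incube (R := R) H p s E x ->
     incube H p (gsec inv act g s) (map (wimg act g) E) (actX inv act g x)) /\
  (forall g x y, inX H p x -> inX H p y ->
     dX H p (actX (R := R) inv act g x) (actX inv act g y) = dX H p x y) /\
  (* the action on X is proper *)
  (forall x, inX (R := R) H p x -> forall gs : nat -> G, leaves_finite gs ->
     forall M : R, exists N, forall n, (N <= n)%N ->
       M <= dX H p (actX inv act (gs n) x) x) /\
  (* if I(W) is finite then dim X = I(W) *)
  (forall n, I_is H n -> dim_is H p n).
Proof.
split; first exact: CAT0_inX hW.
split; first by move=> g s; exact: (gsec_gamma hW hG hact hHinv).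
split; first by move=> s w _ _; exact: (gsec1 hG hact).
split; first by move=> g k s w _ _; exact: (gsecM hG hact).
split; first by move=> g s _; exact: (actX_vpt hG hact hHinv).
split; first by move=> g x; exact: (inX_actX hW hG hact hHinv).
split; first by move=> x _; exact: (actX1 hG hact).
split; first by move=> g k x _; exact: (actXM hG hact).
split; first by move=> g s E x; exact: (incube_actX hW hG hact hHinv).
split; first by move=> g x y _ _; exact: (dX_actX hW hG hact hHinv).
split; first by move=> x; exact: (proper_actX hW hG hact hHinv hprop).
by move=> n; exact: dimension_crossing.
Qed.
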